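(* Let $(f,g),(F,G)\in\mathscr{C}_6(I)$ and let $\mu$ denote the Lebesgue measure restricted to $[0,1]$. Then the following assertions are equivalent: (i) The means $M_{f,g;\mu}$ and $M_{F,G;\mu}$ are equal on $I^2$. (ii) The means $M_{f,g;\mu}$ and $M_{F,G;\mu}$ are equal near the diagonal of $I^2$. (iii) For all $x\in I$, the equalities $m_{x;f,g;\mu}''(0)=m_{x;F,G;\mu}''(0)$, $m_{x;f,g;\mu}''''(0)=m_{x;F,G;\mu}''''(0)$ and $m_{x;f,g;\mu}''''''(0)=m_{x;F,G;\mu}''''''(0)$ (derivatives of order 2, 4 and 6) are satisfied. (iv) $\Phi_{f,g}=\Phi_{F,G}=:\Phi$ and there exist constants $\alpha,\beta\in\mathbb{R}$ such that $$\Psi_{f,g}=\alpha\big(W_{f,g}^{1,0}\big)^{\frac23}+\frac13\Phi'-\frac29\Phi^2\qquad\text{and}\qquad \Psi_{F,G}=\beta\big(W_{f,g}^{1,0}\big)^{\frac23}+\frac13\Phi'-\frac29\Phi^2$$ hold on $I$. (v) Either $(f,g)\sim(F,G)$ or there exist real constants $a,b,c,A,B,C,\gamma$ such that $$af^2+bfg+cg^2=\big(W_{f,g}^{1,0}\big)^{\frac23}\qquad\text{and}\qquad AF^2+BFG+CG^2=\big(W_{F,G}^{1,0}\big)^{\frac23}$$ and $W_{F,G}^{1,0}=\gamma W_{f,g}^{1,0}$. (vi) Either $(f,g)\sim(F,G)$ or there exist two real polynomials $P$ and $Q$ of at most second degree which are positive on the range of $f/g$ and $F/G$, respectively, and there exist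 real constants $\gamma$ and $\delta$ such that $$g=\bigg(\frac fg\bigg)'\bigg(\frac1{\sqrt{P^3}}\circ\frac fg\bigg),\quad G=\bigg(\frac FG\bigg)'\bigg(\frac1{\sqrt{Q^3}}\circ\frac FG\bigg),\quad\text{and}\quad \bigg(\int\frac1Q\bigg)\circ\frac FG=\gamma^{\frac13}\bigg(\int\frac1P\bigg)\circ\frac fg+\delta.$$ (vii) Either $(f,g)\sim(F,G)$ or there exist a strictly monotone differentiable function $\varphi:I\to\mathbb{R}$ and real constants $\alpha$ and $\beta$ such that $$(f,g)\sim(\varphi'\cdot S_\alpha\circ\varphi,\;\varphi'\cdot C_\alpha\circ\varphi)\qquad\text{and}\qquad (F,G)\sim(\varphi'\cdot S_\beta\circ\varphi,\;\varphi'\cdot C_\beta\circ\varphi).$$ (viii) Either $(f,g)\sim(F,G)$ or $M_{f,g;\mu}=A_\varphi=M_{F,G;\mu}$ holds on $I^2$ with $\varphi:=\int\big(W_{f,g}^{1,0}\big)^{\frac13}$. (ix) Either $(f,g)\sim(F,G)$ or there exists a strictly monotone function $\varphi:I\to\mathbb{R}$ such that $M_{f,g;\mu}=A_\varphi=M_{F,G;\mu}$ holds on $I^2$.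
   Context: Throughout, $I$ is a nonempty open real interval. For $n\in\mathbb{N}$, $\mathscr{C}_n(I)$ is the class of all pairs $(f,g)$ of $n$-times continuously differentiable functions $f,g:I\to\mathbb{R}$ such that $g$ is positive on $I$ and $f'g-fg'$ does not vanish anywhere on $I$ (so $f/g$ is continuous and strictly monotone). For a pair $(f,g)$ of continuous functions with $g>0$ and $f/g$ strictly monotone, and a Borel probability measure $\mu$ on $[0,1]$, define $M_{f,g;\mu}:I^2\to I$ by $$M_{f,g;\mu}(x,y):=\Big(\frac fg\Big)^{-1}\left(\frac{\int_0^1 f(tx+(1-t)y)\,d\mu(t)}{\int_0^1 g(tx+(1-t)y)\,d\mu(t)}\right).$$ Let $\widehat\mu_1:=\int_0^1 t\,d\mu(t)$. For fixed $x\in I$ and $u$ in a neighborhood of $0$, put $$m_{x;f,g;\mu}(u):=M_{f,g;\mu}\big(x+(1-\widehat\mu_1)u,\;x-\widehat\mu_1u\big).$$ Two such means are equal near the diagonal $\Delta(I):=\{(x,x)\mid x\in I\}$ of $I^2$ if there exists an open set $U\subseteq I^2$ containing a dense subset $D$ of $\Delta(I)$ such that the two means are equal at every point of $U$. Wronskian-type determinants: $W_{f,g}^{i,j}:=f^{(i)}g^{(j)}-f^{(j)}g^{(i)}$; and $$\Phi_{f,g}:=\frac{W_{f,g}^{2,0}}{W_{f,g}^{1,0}},\qquad \Psi_{f,g}:=-\frac{W_{f,g}^{2,1}}{W_{f,g}^{1,0}}.$$ For pairs of functions $I\to\mathbb{R}$, $(f,g)\sim(F,G)$ means that there exist real constants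 $a,b,c,d$ with $ad\neq bc$ such that $F=af+bg$ and $G=cf+dg$. For a continuous strictly monotone $\varphi:I\to\mathbb{R}$, $A_\varphi(x,y):=\varphi^{-1}\big(\frac{\varphi(x)+\varphi(y)}2\big)$ is the quasiarithmetic mean generated by $\varphi$. For $t\in\mathbb{R}$, $S_t,C_t:\mathbb{R}\to\mathbb{R}$ are: $S_t(x)=\sin(\sqrt{-t}\,x)$, $C_t(x)=\cos(\sqrt{-t}\,x)$ if $t<0$; $S_0(x)=x$, $C_0(x)=1$; $S_t(x)=\sinh(\sqrt t\,x)$, $C_t(x)=\cosh(\sqrt t\,x)$ if $t>0$. The symbol $\int h$ denotes an antiderivative of $h$ (on $I$, or on the interval $(f/g)(I)$, resp. $(F/G)(I)$, for $1/P$, resp. $1/Q$). Powers with exponent $\frac13$ are real cube roots (also of negative numbers) and $w^{2/3}:=(w^{1/3})^2=|w|^{2/3}$.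
   Formalization: In (iv) the alternative ''(f,g)∼(F,G) or'' is added (literal (iv) fails for f=F=exp, g=G=1); in (vi) |(f/g)'| and |(F/G)'| replace (f/g)' and (F/G)' (literal (vi) fails for (−x,1), (e^x,e^{−x}), where f/g decreases). *)

(* Defs.v *)
From HB Require Import structures.
From mathcomp Require Import all_boot all_order all_algebra.
From mathcomp Require Import all_classical all_reals all_analysis.
Import Order.TTheory GRing.Theory Num.Theory.
Import numFieldNormedType.Exports.

Set Implicit Arguments.
Unset Strict Implicit.
Unset Printing Implicit Defensive.

Local Open Scope ring_scope.
Local Open Scope classical_set_scope.

(* A function on the open interval I is a total function R -> R of which only
   the values on I matter: I is open, so derivatives at points of I do not see
   the values outside I. *)

Definition Cn (R : realType) (n : nat) (I : set R) (f : R -> R) : Prop :=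
  (forall k x, (k < n)%N -> I x -> derivable (derive1n k f) x 1) /\
  (forall x, I x -> {for x, continuous (derive1n n f)}).

Definition Cn_pair (R : realType) (n : nat) (I : set R) (f g : R -> R) : Prop :=
  [/\ Cn n I f, Cn n I g, forall x, I x -> 0 < g x &
      forall x, I x -> derive1 f x * g x - f x * derive1 g x != 0].

Definition strictly_monotone (R : realType) (I : set R) (phi : R -> R) : Prop :=
  {in I &, {homo phi : x y / x < y}} \/ {in I &, {homo phi : x y /~ x < y}}.

(* [inv_on I h] is the inverse of the restriction of h to I; its values
   outside h(I) are junk. *)
Definition inv_on (R : realType) (I : set R) (h : R -> R) : R -> R :=
  'pinv_(fun=> 0) I h.

Definition lebesgue01 (R : realType) : set (measurableTypeR R) -> \bar R :=
  mrestr (@lebesgue_measure R) (measurable_itv `[0, 1]%R).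

HB.instance Definition _ (R : realType) := Measure.on (@lebesgue01 R).

Lemma lebesgue01_setT (R : realType) : @lebesgue01 R setT = 1%:E.
Proof.
by rewrite /lebesgue01 /mrestr setTI lebesgue_measure_itv /= lte_fin ltr01 oppr0 adde0.
Qed.

HB.instance Definition _ (R : realType) :=
  @Measure_isProbability.Build _ _ R (@lebesgue01 R) (@lebesgue01_setT R).

Section means.
Context (R : realType) (I : set R) (f g : R -> R).
Context (mu : probability (measurableTypeR R) R).

Definition gmean (x y : R) : R :=
  inv_on I (fun z => f z / g z)
    ((\int[mu]_(t in `[0, 1]) f (t * x + (1 - t) * y)) /
     (\int[mu]_(t in `[0, 1]) g (t * x + (1 - t) * y))).

Definition moment1 : R := \int[mu]_(t in `[0, 1]) t.

Definition gmean_diag (x u : R) : R :=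
  gmean (x + (1 - moment1) * u) (x - moment1 * u).

End means.

Definition qa_mean (R : realType) (I : set R) (phi : R -> R) (x y : R) : R :=
  inv_on I phi ((phi x + phi y) / 2).

Definition eq_on_square (R : realType) (I : set R) (M N : R -> R -> R) : Prop :=
  forall x y, I x -> I y -> M x y = N x y.

Definition eq_near_diagonal (R : realType) (I : set R) (M N : R -> R -> R) : Prop :=
  let Delta := [set (x, x) | x in I] in
  exists U D : set (R * R),
    [/\ open U, U `<=` I `*` I, D `<=` Delta, Delta `<=` closure D & D `<=` U] /\
    (forall p, U p -> M p.1 p.2 = N p.1 p.2).

Definition W (R : realType) (i j : nat) (f g : R -> R) (x : R) : R :=
  derive1n i f x * derive1n j g x - derive1n j f x * derive1n i g x.

Definition Phi (R : realType) (f g : R -> R) (x : R) : R :=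
  W 2 0 f g x / W 1 0 f g x.

Definition Psi (R : realType) (f g : R -> R) (x : R) : R :=
  - (W 2 1 f g x / W 1 0 f g x).

Definition pair_equiv (R : realType) (I : set R) (f g F G : R -> R) : Prop :=
  exists a b c d : R, a * d != b * c /\
    forall x, I x -> F x = a * f x + b * g x /\ G x = c * f x + d * g x.

Definition S_ (R : realType) (t x : R) : R :=
  if t < 0 then sin (Num.sqrt (- t) * x)
  else if t == 0 then x
  else (expR (Num.sqrt t * x) - expR (- (Num.sqrt t * x))) / 2.

Definition C_ (R : realType) (t x : R) : R :=
  if t < 0 then cos (Num.sqrt (- t) * x)
  else if t == 0 then 1
  else (expR (Num.sqrt t * x) + expR (- (Num.sqrt t * x))) / 2.

(* powR is only meaningful at nonnegative bases; this is the odd extension. *)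
Definition cbrt (R : realType) (w : R) : R := Num.sg w * (`|w| `^ 3^-1).

Definition antiderivative (R : realType) (J : set R) (h H : R -> R) : Prop :=
  forall x, J x -> is_derive x 1 H (h x).

(* Main.v *)
(* Put W = W_{f,g}^{1,0} and w = W^(2/3).  Both f and g solve
   h'' = Phi h' + Psi h, and W' = Phi W.  Near u = 0 the diagonal mean m is
   determined by f(m) J_g = g(m) J_f, where J_h is the average of h over the
   segment, so its Taylor coefficients at u^2, u^4, u^6 are polynomials in
   the derivatives of Phi and Psi.  Equality of the second derivatives gives
   Phi_{f,g} = Phi_{F,G}; then equality of the fourth ones says that
   d = Psi_{f,g} - Psi_{F,G} satisfies d' = (2/3) Phi d, so d is a constant
   multiple of w; and equality of the sixth ones says that d z = 0, where
   z = r' - (2/3) Phi r and r = Psi - Phi'/3 + (2/9) Phi^2.  Hence either d = 0,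
   and the pairs span the same solution space, or z = 0, and r is a constant
   multiple of w.  In the latter case the substitution phi' = W^(1/3),
   f = phi' (p o phi) turns the equation into p'' = alpha p, whose solutions
   have quasiarithmetic means because sinh, sin and id are odd. *)

Require Import Defs.
From mathcomp Require Import all_boot all_order all_algebra.
From mathcomp Require Import all_classical all_reals all_analysis.
From mathcomp Require Import ring lra.
Import Order.TTheory GRing.Theory Num.Theory.
Import numFieldNormedType.Exports.
Local Open Scope ring_scope.
Local Open Scope classical_set_scope.
Set Implicit Arguments.
Unset Strict Implicit.
Unset Printing Implicit Defensive.

(** * Calculus on an open interval *)

(** Two obstacles shape the proof. The first is regularity: [Phi] and [Psi] are only of class C^4,
    and the sixth derivative of f already contains Psi'''' f. Pairing with f and g themselves in a
    Wronskian of index (6,0) removes this multiple of f, so the coefficient of u^6 involves Psi only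
    up to order 3 and can be compared and varied in x. The expansion of m is obtained implicitly: it
    is substituted into f(m) J_g - g(m) J_f = 0, whose antisymmetry in f and g turns all
    coefficients into Wronskians. As m - x = O(u^2), three derivatives of f and g at x suffice for
    the factors f(m) and g(m) up to order six. The second is the passage from points to functions: d
    z = 0 is an alternative at each point, and it becomes one on I because d is a constant multiple
    of the nowhere vanishing w. In the same spirit, every constant in (iv) and (v) arises from an
    explicit expression with zero derivative: a quotient of two solutions of y' = q y, or a first
    integral. In (vii) phi is differentiable only once, so phi'' must never be formed. *)

Section derivation_rules.
Variable R : realType.
Implicit Types (f g h : R -> R) (x a b c : R) (I : set R).

Lemma is_derive_val f x a : is_derive x 1 f a -> derive1 f x = a.
Proof. by move=> fa; rewrite derive1E derive_val. Qed.

Lemma derivable_is_derive f x : derivable f x 1 -> is_derive x 1 f (derive1 f x).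
Proof. by move=> df; rewrite derive1E; exact/derivableP. Qed.

Lemma is_derive_derivable f x a : is_derive x 1 f a -> derivable f x 1.
Proof. by case. Qed.

Lemma is_derive_continuous f x a : is_derive x 1 f a -> {for x, continuous f}.
Proof. by move=> df; exact/differentiable_continuous/derivable1_diffP. Qed.

Lemma is_derive_rew f x a b : is_derive x 1 f a -> a = b -> is_derive x 1 f b.
Proof. by move=> + <-. Qed.

Lemma is_derive_cstE c x : is_derive x 1 (fun=> c) 0.
Proof. exact: is_derive_cst. Qed.

Lemma is_derive_idE x : is_derive x 1 (fun y : R => y) 1.
Proof. exact: is_derive_id. Qed.

Lemma is_deriveDE f g x a b : is_derive x 1 f a -> is_derive x 1 g b ->
  is_derive x 1 (fun y => f y + g y) (a + b).
Proof. exact: is_deriveD. Qed.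

Lemma is_deriveNE f x a : is_derive x 1 f a -> is_derive x 1 (fun y => - f y) (- a).
Proof. exact: is_deriveN. Qed.

Lemma is_deriveME f g x a b : is_derive x 1 f a -> is_derive x 1 g b ->
  is_derive x 1 (fun y => f y * g y) (a * g x + f x * b).
Proof.
move=> fa gb; have /is_derive_rew := is_deriveM fa gb; apply.
by rewrite addrC [g x *: a]mulrC.
Qed.

Lemma is_deriveXE f n x a : is_derive x 1 f a ->
  is_derive x 1 (fun y => f y ^+ n) (n%:R * f x ^+ n.-1 * a).
Proof.
move=> fa; have := is_deriveX n fa.
by rewrite [X in is_derive _ _ X](_ : _ = fun y => f y ^+ n)// exprfctE.
Qed.

Lemma is_deriveVE f x a : f x != 0 -> is_derive x 1 f a ->
  is_derive x 1 (fun y => (f y)^-1) (- (f x) ^- 2 * a).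
Proof. exact: is_deriveV. Qed.

Lemma is_derive_compE f g x a b : is_derive (g x) 1 f a -> is_derive x 1 g b ->
  is_derive x 1 (fun y => f (g y)) (a * b).
Proof. exact: is_derive1_comp. Qed.

Lemma continuous_compE f g x : {for x, continuous f} -> {for f x, continuous g} ->
  {for x, continuous (fun y => g (f y))}.
Proof. exact: continuous_comp. Qed.

Lemma continuousME f g x : {for x, continuous f} -> {for x, continuous g} ->
  {for x, continuous (fun y => f y * g y)}.
Proof. exact: continuousM. Qed.

Lemma is_derive_near f g x a :
  (\forall y \near x, f y = g y) -> is_derive x 1 f a -> is_derive x 1 g a.
Proof. by move=> fg; apply: near_eq_is_derive => //; rewrite oner_eq0. Qed.

Lemma near_eq_continuous f g x :
  (\forall y \near x, f y = g y) -> {for x, continuous f} -> {for x, continuous g}.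
Proof.
move=> fg cf; rewrite /prop_for /continuous_at -(nbhs_singleton fg).
exact: cvg_trans (near_eq_cvg fg) cf.
Qed.

Lemma near_eq_derive1 f g x :
  (\forall y \near x, f y = g y) -> derive1 f x = derive1 g x.
Proof.
by move=> fg; rewrite !derive1E; apply: near_eq_derive => //; exact: oner_neq0.
Qed.

Lemma near_eq_derive1n f g x n :
  (\forall y \near x, f y = g y) -> \forall y \near x, derive1n n f y = derive1n n g y.
Proof.
move=> fg; elim: n => [//|n]; rewrite !derive1nS => /near_join ih.
by near=> y; apply: near_eq_derive1; near: y.
Unshelve. all: by end_near. Qed.

Lemma eq_derive1n f g x n :
  (\forall y \near x, f y = g y) -> derive1n n f x = derive1n n g x.
Proof. by move=> /(near_eq_derive1n n) /nbhs_singleton. Qed.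

Lemma derive1Sn n f : derive1n n.+1 f = derive1n n (derive1 f).
Proof. by rewrite /derive1n iterSr. Qed.

End derivation_rules.

(* [apply] would let type class resolution close the subgoals with the
   instances of the library, whose derivatives are stated with [*:]. *)
Ltac derive_step :=
  first [ eassumption
        | notypeclasses refine (is_derive_cstE _ _)
        | notypeclasses refine (is_derive_idE _)
        | notypeclasses refine (is_deriveDE _ _)
        | notypeclasses refine (is_deriveNE _)
        | notypeclasses refine (is_deriveXE _ _)
        | notypeclasses refine (is_deriveME _ _) ].
Ltac derive_comp := notypeclasses refine (is_derive_compE _ _).
Ltac derive_by tac :=
  notypeclasses refine (is_derive_rew _ _); [ repeat derive_step | cbv beta; tac ].

Section open_interval.
Variables (R : realType) (I : set R).
Hypotheses (I_itv : is_interval I) (I_open : open I).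
Implicit Types (f g h k : R -> R) (x y a b c : R).

Lemma near_open x : I x -> \forall y \near x, I y.
Proof. by move=> Ix; apply: open_nbhs_nbhs. Qed.

Lemma open_ball x : I x -> exists2 e, 0 < e & forall y, `|y - x| < e -> I y.
Proof.
move=> /near_open/nbhs_ballP[e e0 eI]; exists e => // y yx.
by apply: eI; rewrite /ball /= distrC.
Qed.

Lemma itv_between x y z : I x -> I y -> x <= z <= y -> I z.
Proof. by move=> Ix Iy; exact: I_itv. Qed.

Lemma itv_convex x y t : I x -> I y -> 0 <= t <= 1 -> I (t * x + (1 - t) * y).
Proof.
move=> Ix Iy /andP[t0 t1]; case: (leP x y) => xy.
  by apply: (itv_between Ix Iy); apply/andP; split; nra.
by apply: (itv_between Iy Ix); apply/andP; split; nra.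
Qed.

Lemma continuous_within h x y :
  (forall z, I z -> {for z, continuous h}) -> I x -> I y ->
  {within `[x, y], continuous h}.
Proof.
move=> ch Ix Iy; apply: continuous_in_subspaceT => z /set_mem /=.
by rewrite in_itv /= => xzy; apply: ch; exact: itv_between xzy.
Qed.

Lemma MVT_open h k x y : (forall z, I z -> is_derive z 1 h (k z)) ->
  I x -> I y -> x < y -> exists z, [/\ I z, x < z < y & h y - h x = k z * (y - x)].
Proof.
move=> hk Ix Iy xy.
have [z||z zxy E] := @MVT _ h k x y xy.
- rewrite in_itv /= => /andP[/ltW xz /ltW zy]; apply: hk.
  by apply: (itv_between Ix Iy); rewrite xz.
- by apply: continuous_within => // z /hk; exact: is_derive_continuous.
exists z; move: zxy; rewrite in_itv /= => /andP[xz zy]; split => //; last by rewrite xz.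
by apply: (itv_between Ix Iy); rewrite !ltW.
Qed.

Lemma is_derive0_constant h x y :
  (forall z, I z -> is_derive z 1 h 0) -> I x -> I y -> h x = h y.
Proof.
move=> h0; wlog xy : x y / x < y.
  move=> H Ix Iy; case: (ltgtP x y) => [xy|yx|->//]; first exact: H.
  by apply/esym; exact: H.
move=> Ix Iy; have [z [_ _ /eqP]] := MVT_open h0 Ix Iy xy.
by rewrite mul0r subr_eq0 eq_sym => /eqP.
Qed.

(** By the intermediate value theorem opposite signs would force a zero in between. Applied to the
    derivative of f/g, this upgrades the nonvanishing Wronskian to strict monotonicity. *)
Lemma constant_sign k :
  (forall x, I x -> {for x, continuous k}) -> (forall x, I x -> k x != 0) ->
  (forall x, I x -> 0 < k x) \/ (forall x, I x -> k x < 0).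
Proof.
move=> ck k0.
have noswitch x y : I x -> I y -> 0 < k x -> k y < 0 -> False.
  move=> Ix Iy kx ky.
  have [xy|yx] := leP x y.
  - have cw := continuous_within ck Ix Iy.
    have [|z] := @IVT _ k x y 0 xy cw.
      by rewrite ge_min le_max (ltW kx) (ltW ky) orbT.
    by rewrite in_itv /= => /(itv_between Ix Iy)/k0/eqP.
  - have cw := continuous_within ck Iy Ix.
    have [|z] := @IVT _ k y x 0 (ltW yx) cw.
      by rewrite ge_min le_max (ltW kx) (ltW ky) orbT.
    by rewrite in_itv /= => /(itv_between Iy Ix)/k0/eqP.
have [[x [Ix kx]]|nex] := pselect (exists x, I x /\ 0 < k x).
  left=> y Iy; case: (ltgtP (k y) 0) => // [ky|ky].
    by case: (noswitch x y).
  by move: (k0 y Iy); rewrite ky eqxx.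
right=> y Iy; case: (ltgtP (k y) 0) => // ky; first by case: nex; exists y.
by move: (k0 y Iy); rewrite ky eqxx.
Qed.

Lemma derive_neq0_strictly_monotone h k :
  (forall x, I x -> is_derive x 1 h (k x)) ->
  (forall x, I x -> {for x, continuous k}) -> (forall x, I x -> k x != 0) ->
  strictly_monotone I h.
Proof.
move=> hk ck k0; have [kp|kn] := constant_sign ck k0; [left|right].
- move=> x y /set_mem Ix /set_mem Iy xy.
  have [z [Iz _ E]] := MVT_open hk Ix Iy xy.
  by rewrite -subr_gt0 E mulr_gt0 ?kp ?subr_gt0.
- move=> x y /set_mem Ix /set_mem Iy xy.
  have [z [Iz _ E]] := MVT_open hk Iy Ix xy.
  by rewrite -subr_lt0 E nmulr_rlt0 ?kn ?subr_gt0.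
Qed.

Lemma strictly_monotone_inj h : strictly_monotone I h -> {in I &, injective h}.
Proof.
move=> [] hm x y Ix Iy hxy; apply/eqP; rewrite eq_le; apply/andP; split.
all: by rewrite leNgt; apply/negP => /hm; rewrite ?Ix ?Iy hxy ltxx => /(_ isT isT).
Qed.

Lemma inv_onK h x : {in I &, injective h} -> I x -> inv_on I h (h x) = x.
Proof. by move=> hi Ix; apply: (pinvKV (fun=> 0) hi); rewrite inE. Qed.

Lemma is_derive_inv_on h k x : {in I &, injective h} ->
  (forall x, I x -> is_derive x 1 h (k x)) -> I x -> k x != 0 ->
  is_derive (h x) 1 (inv_on I h) (k x)^-1.
Proof.
move=> hi hk Ix k0; apply: is_derive_inverse (hk _ Ix) k0.
- by near=> y; apply: inv_onK => //; near: y; exact: near_open.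
- near=> y; apply: is_derive_continuous (hk _ _).
  by near: y; exact: near_open.
Unshelve. all: by end_near. Qed.

End open_interval.

(** * Averages over a segment *)

Section integrals.
Variable R : realType.
Notation leb := (@lebesgue_measure R).
Implicit Types (f g h H : R -> R) (x y a b c : R).

Lemma Rintegral_lebesgue01 h :
  \int[@lebesgue01 R]_(t in `[0, 1]) h t = \int[leb]_(t in `[0, 1]) h t.
Proof.
congr fine; apply: eq_measure_integral => A mA A01.
by rewrite /lebesgue01 /mrestr/=; congr (leb _); exact: setIidl.
Qed.

Lemma continuous_integrable h a b : {within `[a, b], continuous h} ->
  leb.-integrable `[a, b] (EFin \o h).
Proof. by move=> ch; apply: continuous_compact_integrable => //; exact: segment_compact. Qed.

Lemma Rintegral_is_derive h H a b : a <= b ->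
  (forall x, a <= x <= b -> is_derive x 1 H (h x)) ->
  {within `[a, b], continuous h} ->
  \int[leb]_(x in `[a, b]) h x = H b - H a.
Proof.
rewrite le_eqVlt => /predU1P[<-|ab] Hh ch.
  by rewrite set_itv1 Rintegral_set1 subrr.
have cH x : a <= x <= b -> {for x, continuous H}.
  by move=> /Hh; exact: is_derive_continuous.
rewrite /Rintegral (@continuous_FTC2 _ h H)//=.
- split.
  + move=> x; rewrite in_itv/= => /andP[/ltW ax /ltW xb].
    by apply: is_derive_derivable; apply: Hh; rewrite ax.
  + by apply: cvg_at_right_filter; apply: cH; rewrite lexx ltW.
  + by apply: cvg_at_left_filter; apply: cH; rewrite lexx ltW.
- move=> x; rewrite in_itv/= => /andP[/ltW ax /ltW xb].
  by apply: is_derive_val; apply: Hh; rewrite ax.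
Qed.

Variable I : set R.
Hypotheses (I_itv : is_interval I) (I_open : open I).

(** The oriented integral from a base point [a] works: near [x] both of its branches differ by the
    same constant from the integral over [c, y], where [c] lies to the left of [a] and [x], so the
    fundamental theorem for a fixed left endpoint applies. *)
Lemma antiderivative_exists h : (forall x, I x -> {for x, continuous h}) ->
  exists H, antiderivative I h H.
Proof.
move=> ch; have [[a Ia]|I0] := pselect (I !=set0); last first.
  by exists h => x Ix; case: I0; exists x.
pose H x := if a <= x then \int[leb]_(t in `[a, x]) h t
            else - \int[leb]_(t in `[x, a]) h t.
exists H => x Ix.
have [c [Ic cx ca]] : exists c, [/\ I c, c < x & c < a].
  suff [c [Ic cm]] : exists c, I c /\ c < Num.min a x.
    by exists c; move: cm; rewrite lt_min => /andP[].
  have Im : I (Num.min a x) by case: leP.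
  have [e e0 mI] := open_ball I_open Im.
  exists (Num.min a x - e / 2); split; last by rewrite gtrBl; nra.
  by apply: mI; rewrite addrAC subrr add0r normrN gtr0_norm; nra.
have [d [Id xd]] : exists d, I d /\ x < d.
  have [e e0 xI] := open_ball I_open Ix.
  exists (x + e / 2); split; last by rewrite ltrDl; nra.
  by apply: xI; rewrite addrAC subrr add0r gtr0_norm; nra.
have cw u v : I u -> I v -> {within `[u, v], continuous h}.
  exact: (continuous_within I_itv).
have intb u v : I u -> I v -> leb.-integrable `[u, v] (EFin \o h).
  by move=> Iu Iv; exact/continuous_integrable/cw.
have split_int u v : I u -> I v -> c <= u -> u <= v ->
  \int[leb]_(t in `[u, v]) h t =
  \int[leb]_(t in `[c, v]) h t - \int[leb]_(t in `[c, u]) h t.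
  move=> Iu Iv cu uv.
  rewrite (@Rintegral_itvB _ h (BLeft c) (BRight v) u) ?bnd_simp//; last exact: intb.
  rewrite Rintegral_itv_obnd_cbnd//.
  by apply: integrableS (intb u v Iu Iv) => //; apply: subset_itvr; rewrite bnd_simp.
have [dF F'] : derivable (fun y => \int[leb]_(t in `[c, y]) h t) x 1 /\
     derive1 (fun y => \int[leb]_(t in `[c, y]) h t) x = h x.
  apply: (@continuous_FTC1_closed _ h c x d) => //; first exact: intb.
  exact: ch.
have {dF F'} dF : is_derive x 1 (fun y => \int[leb]_(t in `[c, y]) h t) (h x).
  by rewrite -F'; exact: derivable_is_derive.
have := is_deriveDE dF (is_derive_cstE (- \int[leb]_(t in `[c, a]) h t) x).
rewrite addr0; apply: is_derive_near; near=> y.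
have Iy : I y by near: y; exact: near_open.
have cy : c < y by near: y; exact: lt_nbhsr.
rewrite /H; case: leP => [ay|/ltW ya].
  by rewrite (split_int a y)// ?ltW//.
by rewrite (split_int y a)// ?ltW// opprB.
Unshelve. all: by end_near. Qed.

Lemma continuous_segment h x y :
  (forall z, I z -> {for z, continuous h}) -> I x -> I y ->
  {within `[0, 1], continuous (fun t => h (t * x + (1 - t) * y))}.
Proof.
move=> ch Ix Iy; apply: continuous_in_subspaceT => t /set_mem /=.
rewrite in_itv /= => t01.
apply: (continuous_compE (f := fun t => t * x + (1 - t) * y)).
  by apply: is_derive_continuous; derive_by reflexivity.
by apply: ch; exact: itv_convex.
Qed.

Definition segment_mean h x y := \int[leb]_(t in `[0, 1]) h (t * x + (1 - t) * y).

(** Substitution z = t x + (1 - t) y. Keeping the factor x - y on the left covers both orders of x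
    and y and the case x = y. *)
Lemma segment_meanE h H x y : (forall z, I z -> {for z, continuous h}) ->
  antiderivative I h H -> I x -> I y ->
  (x - y) * segment_mean h x y = H x - H y.
Proof.
move=> ch hH Ix Iy; have cs := continuous_segment ch Ix Iy.
rewrite -RintegralZl//; last exact: continuous_integrable.
apply: etrans; first apply: (Rintegral_is_derive (H := fun t => H (t * x + (1 - t) * y))).
- exact: ler01.
- move=> t t01; notypeclasses refine (is_derive_rew _ _).
    derive_comp; first by apply: hH; exact: itv_convex.
    by repeat derive_step.
  by rewrite /=; ring.
- apply: (@continuous_segment (fun z => (x - y) * h z)) => // z Iz.
  by apply: continuousM; [exact: cvg_cst|exact: ch].
- by congr (H _ - H _); ring.
Qed.

End integrals.

(** * Real cube roots *)

Section cube_root.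
Variable R : realType.
Implicit Types w x : R.

Lemma cbrtK w : cbrt w ^+ 3 = w.
Proof.
rewrite /cbrt exprMn -[X in _ * X]powR_mulrn ?powR_ge0// -powRrM mulVf// powRr1//.
case: (ltgtP w 0) => w0.
- by rewrite ltr0_sg// ltr0_norm//; ring.
- by rewrite gtr0_sg// gtr0_norm//; ring.
- by rewrite w0 sgr0; ring.
Qed.

Lemma cube_inj : injective (fun x : R => x ^+ 3).
Proof.
move=> x y /eqP; rewrite -subr_eq0.
have -> : x ^+ 3 - y ^+ 3 = (x - y) * ((x + y / 2) ^+ 2 + 3 / 4 * y ^+ 2) by field.
rewrite mulf_eq0 subr_eq0 => /orP[/eqP//|/eqP E].
have y0 : y = 0 by apply/eqP; rewrite -sqrf_eq0; apply/eqP; nra.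
have x0 : x = 0 by apply/eqP; rewrite -sqrf_eq0; apply/eqP; move: E; rewrite y0; nra.
by rewrite x0 y0.
Qed.

Lemma cubeK x : cbrt (x ^+ 3) = x.
Proof. by apply: cube_inj; rewrite /= cbrtK. Qed.

Lemma cbrtM w x : cbrt (w * x) = cbrt w * cbrt x.
Proof. by apply: cube_inj; rewrite /= [RHS]exprMn !cbrtK. Qed.

Lemma cbrt_eq0 w : (cbrt w == 0) = (w == 0).
Proof. by rewrite -[in RHS](cbrtK w) expf_eq0. Qed.

(** The inverse function rule is applied to the cube, instead of differentiating the sign and the
    real power in [cbrt]. *)
Lemma is_derive_cbrt w : w != 0 -> is_derive w 1 (@cbrt R) (3 * cbrt w ^+ 2)^-1.
Proof.
move=> w0; rewrite -{1}(cbrtK w).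
apply: (is_derive_inverse (f := fun x => x ^+ 3)).
- by near=> x; exact: cubeK.
- by near=> x; apply: is_derive_continuous; derive_by reflexivity.
- by derive_by ltac:(rewrite mulr1).
- by rewrite mulf_neq0// ?expf_neq0// ?cbrt_eq0// pnatr_eq0.
Unshelve. all: by end_near. Qed.

End cube_root.

(** * Closure properties of the differentiability classes *)

Section Cn_closure.
Variable R : realType.
Implicit Types (f g : R -> R) (x : R) (N I : set R).

Lemma Cn0 N f : (forall x, N x -> {for x, continuous f}) -> Cn 0 N f.
Proof. by split. Qed.

(** The definition adds derivatives on the outside, whereas inductions on the order have to split
    off the innermost one. *)
Lemma CnS n N f : Cn n.+1 N f <->
  (forall x, N x -> derivable f x 1) /\ Cn n N (derive1 f).
Proof.
split=> [[df cf]|[df [d2f cf]]].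
  split; first by move=> x; exact: (df 0%N).
  by split=> [k x kn|]; rewrite -derive1Sn; [exact: df|exact: cf].
split=> [[|k] x kn Nx|x Nx]; rewrite ?derive1Sn; [exact: df|exact: d2f|exact: cf].
Qed.

Lemma CnW n N f : Cn n.+1 N f -> Cn n N f.
Proof.
move=> [df cf]; split=> [k x kn|x Nx]; first by apply: df; exact: ltnW.
by apply: (is_derive_continuous (a := derive1 (derive1n n f) x)); exact/derivable_is_derive/df.
Qed.

Lemma Cn_leq m n N f : (m <= n)%N -> Cn n N f -> Cn m N f.
Proof.
move=> mn; rewrite -(subnKC mn); elim: (n - m)%N => [|k ih]; first by rewrite addn0.
by rewrite addnS => /CnW.
Qed.

Lemma Cn_derive1n m n N f : Cn (m + n) N f -> Cn n N (derive1n m f).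
Proof. by elim: m f => [//|m ih] f /CnS[_ /ih]; rewrite derive1Sn. Qed.

Lemma Cn_continuous n N f x : Cn n N f -> N x -> {for x, continuous f}.
Proof. by move=> /(Cn_leq (leq0n n))[_ +] => /[apply]. Qed.

Lemma Cn_is_derive n N f x : (0 < n)%N -> Cn n N f -> N x ->
  is_derive x 1 f (derive1 f x).
Proof. by case: n => // n _ /CnS[df _] Nx; exact/derivable_is_derive/df. Qed.

Lemma Cn_is_derive1n k n N f x : (k < n)%N -> Cn n N f -> N x ->
  is_derive x 1 (derive1n k f) (derive1n k.+1 f x).
Proof. by move=> kn [df _] Nx; rewrite derive1nS; exact/derivable_is_derive/df. Qed.

Lemma Cn_cst n N (c : R) : Cn n N (fun=> c).
Proof.
elim: n c => [|n ih] c; first by apply: Cn0 => x _; exact: cvg_cst.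
apply/CnS; split=> [x _|]; first exact: derivable_cst.
rewrite (_ : derive1 _ = fun=> 0)//; apply/funext => x.
by apply: is_derive_val; exact: is_derive_cstE.
Qed.

Section open_set.
Variable N : set R.
Hypothesis N_open : open N.

Lemma Cn_ext n f g : (forall x, N x -> f x = g x) -> Cn n N f -> Cn n N g.
Proof.
move=> fg [df cf].
have E x k : N x -> \forall y \near x, derive1n k f y = derive1n k g y.
  move=> Nx; apply: near_eq_derive1n; near=> y; apply: fg; near: y.
  exact: near_open.
split=> [k x kn Nx|x Nx].
  apply: is_derive_derivable (is_derive_near (E _ k Nx) _).
  exact/derivable_is_derive/df.
exact: near_eq_continuous (E _ n Nx) (cf _ Nx).
Unshelve. all: by end_near. Qed.

Lemma Cn_is_deriveS n f f' : (forall x, N x -> is_derive x 1 f (f' x)) ->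
  Cn n N f' -> Cn n.+1 N f.
Proof.
move=> ff' cf'; apply/CnS; split=> [x /ff'|]; first exact: is_derive_derivable.
by apply: Cn_ext cf' => x /ff'/is_derive_val.
Qed.

Lemma CnD n f g : Cn n N f -> Cn n N g -> Cn n N (fun x => f x + g x).
Proof.
elim: n f g => [|n ih] f g cf cg.
  apply: Cn0 => x Nx; apply: continuousD; [exact: (Cn_continuous cf)|exact: (Cn_continuous cg)].
apply: (@Cn_is_deriveS _ _ (fun x => derive1 f x + derive1 g x)).
  by move=> x Nx; apply: is_deriveDE; [exact: (Cn_is_derive _ cf)|exact: (Cn_is_derive _ cg)].
by apply: ih; [case/CnS: cf|case/CnS: cg].
Qed.

Lemma CnM n f g : Cn n N f -> Cn n N g -> Cn n N (fun x => f x * g x).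
Proof.
elim: n f g => [|n ih] f g cf cg.
  apply: Cn0 => x Nx; apply: continuousM; [exact: (Cn_continuous cf)|exact: (Cn_continuous cg)].
apply: (@Cn_is_deriveS _ _ (fun x => derive1 f x * g x + f x * derive1 g x)).
  by move=> x Nx; apply: is_deriveME; [exact: (Cn_is_derive _ cf)|exact: (Cn_is_derive _ cg)].
by apply: CnD; apply: ih; [case/CnS: cf|exact: CnW|exact: CnW|case/CnS: cg].
Qed.

Lemma CnN n f : Cn n N f -> Cn n N (fun x => - f x).
Proof.
move=> cf; apply: (@Cn_ext _ (fun x => -1 * f x)); first by move=> x _; rewrite mulN1r.
by apply: CnM => //; exact: Cn_cst.
Qed.

Lemma CnB n f g : Cn n N f -> Cn n N g -> Cn n N (fun x => f x - g x).
Proof. by move=> cf cg; apply: CnD => //; exact: CnN. Qed.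

Lemma CnV n f : (forall x, N x -> f x != 0) -> Cn n N f -> Cn n N (fun x => (f x)^-1).
Proof.
move=> f0; elim: n => [|n ih] cf.
  by apply: Cn0 => x Nx; apply: continuousV; [exact: f0|exact: (Cn_continuous cf)].
(* The derivative is written with two factors 1/f, so that the induction hypothesis for 1/f itself
   applies to it. *)
apply: (@Cn_is_deriveS _ _ (fun x => - ((f x)^-1 * (f x)^-1) * derive1 f x)).
  move=> x Nx; have /is_derive_rew := is_deriveVE (f0 _ Nx) (Cn_is_derive (ltn0Sn n) cf Nx).
  by apply; rewrite expr2 invfM.
by apply: CnM; [apply: CnN; apply: CnM; exact/ih/CnW|case/CnS: cf].
Qed.

Lemma Cn_comp n I f m : (forall x, N x -> I (m x)) ->
  Cn n I f -> Cn n N m -> Cn n N (fun x => f (m x)).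
Proof.
move=> NI; elim: n f => [|n ih] f cf cm.
  apply: Cn0 => x Nx; apply: continuous_compE; first exact: (Cn_continuous cm).
  by apply: (Cn_continuous cf); exact: NI.
apply: (@Cn_is_deriveS _ _ (fun x => derive1 f (m x) * derive1 m x)).
  move=> x Nx; apply: is_derive_compE; [exact: (Cn_is_derive _ cf (NI _ Nx))|exact: (Cn_is_derive _ cm)].
by apply: CnM; [apply: ih; [case/CnS: cf|exact: CnW]|case/CnS: cm].
Qed.

End open_set.
End Cn_closure.

(** * Averages, quasiarithmetic means and integral means at a pair of points *)

Section mean_values.
Variables (R : realType) (I : set R).
Hypotheses (I_itv : is_interval I) (I_open : open I).
Implicit Types (f g h phi : R -> R) (x y m a b : R).
Notation leb := (@lebesgue_measure R).
Local Notation continuous_on h := (forall z, I z -> {for z, continuous h}).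

Lemma segment_integrable h x y : continuous_on h -> I x -> I y ->
  leb.-integrable `[0, 1] (EFin \o (fun t => h (t * x + (1 - t) * y))).
Proof. by move=> ch Ix Iy; exact/continuous_integrable/(continuous_segment I_itv). Qed.

Lemma segment_mean_linear f g a b x y : continuous_on f -> continuous_on g ->
  I x -> I y ->
  segment_mean (fun z => a * f z + b * g z) x y =
  a * segment_mean f x y + b * segment_mean g x y.
Proof.
move=> cf cg Ix Iy; have cZ c h : continuous_on h -> continuous_on (fun z => c * h z).
  by move=> ch z Iz; apply: continuousM; [exact: cvg_cst|exact: ch].
rewrite /segment_mean.
have int_f := segment_integrable cf Ix Iy.
have int_g := segment_integrable cg Ix Iy.
rewrite -RintegralZl// -RintegralZl// -RintegralD//.
- exact: segment_integrable (cZ a _ cf) Ix Iy.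
- exact: segment_integrable (cZ b _ cg) Ix Iy.
Qed.

Lemma segment_mean_diag h x : segment_mean h x x = h x.
Proof.
rewrite /segment_mean; under eq_Rintegral do rewrite -mulrDl subrKC mul1r.
rewrite Rintegral_cst//= lebesgue_measure_itv/= lte_fin ltr01.
by rewrite oppr0 adde0 mulr1.
Qed.

Lemma segment_meanC h x y : continuous_on h -> I x -> I y ->
  segment_mean h x y = segment_mean h y x.
Proof.
move=> ch Ix Iy; have [->//|xy] := eqVneq x y.
have [H hH] := antiderivative_exists I_itv I_open ch.
apply: (@mulfI _ (x - y)); first by rewrite subr_eq0.
rewrite (segment_meanE I_itv ch hH)//.
by rewrite -(opprB y x) mulNr (segment_meanE I_itv ch hH)// opprB.
Qed.

Lemma segment_mean_value h x y : continuous_on h -> I x -> I y ->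
  exists2 z, I z & segment_mean h x y = h z.
Proof.
move=> ch Ix Iy; wlog xy : x y Ix Iy / x <= y.
  move=> W; have [|/ltW yx] := leP x y; first exact: W.
  by rewrite segment_meanC//; exact: W.
move: xy; rewrite le_eqVlt => /predU1P[->|xy].
  by exists y => //; exact: segment_mean_diag.
have [H hH] := antiderivative_exists I_itv I_open ch.
have [z [Iz _ E]] := MVT_open I_itv hH Ix Iy xy; exists z => //.
apply: (@mulfI _ (x - y)); first by rewrite subr_eq0 lt_eqF.
by rewrite (segment_meanE I_itv ch hH)// -opprB E; ring.
Qed.

Lemma segment_mean_gt0 h x y : continuous_on h -> (forall z, I z -> 0 < h z) ->
  I x -> I y -> 0 < segment_mean h x y.
Proof.
by move=> ch h0 Ix Iy; have [z Iz ->] := segment_mean_value ch Ix Iy; exact: h0.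
Qed.

Lemma qa_mean_eq phi x y m : {in I &, injective phi} -> I m ->
  phi m = (phi x + phi y) / 2 -> qa_mean I phi x y = m.
Proof. by move=> phi_inj Im E; rewrite /qa_mean -E inv_onK. Qed.

Lemma qa_mean_exists phi x y : continuous_on phi -> I x -> I y ->
  exists2 m, I m & phi m = (phi x + phi y) / 2.
Proof.
move=> cphi Ix Iy; wlog xy : x y Ix Iy / x <= y.
  move=> W; have [|/ltW yx] := leP x y; first exact: W.
  by rewrite addrC; exact: W.
have [||m mxy E] := @IVT _ phi x y ((phi x + phi y) / 2) xy.
- exact: (continuous_within I_itv).
- rewrite ge_min le_max.
  by case: (leP (phi x) (phi y)) => c; apply/andP; split; apply/orP;
     (left + right); lra.
by exists m => //; apply: (itv_between I_itv Ix Iy); rewrite in_itv in mxy.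
Qed.

Variables (f g : R -> R).
Hypotheses (cf : continuous_on f) (cg : continuous_on g).
Hypothesis g0 : forall z, I z -> 0 < g z.
Hypothesis fg_inj : {in I &, injective (fun z => f z / g z)}.
Notation M := (gmean I f g (@lebesgue01 R)).

Lemma gmeanE x y : M x y = inv_on I (fun z => f z / g z)
  (segment_mean f x y / segment_mean g x y).
Proof. by rewrite /gmean !Rintegral_lebesgue01. Qed.

Lemma gmean_eq x y m : I x -> I y -> I m ->
  f m * segment_mean g x y = g m * segment_mean f x y -> M x y = m.
Proof.
move=> Ix Iy Im E; have gm := g0 Im.
have gxy := segment_mean_gt0 cg g0 Ix Iy.
rewrite gmeanE -(inv_onK fg_inj Im); congr inv_on.
by apply/eqP; rewrite eqr_div ?lt0r_neq0// E mulrC.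
Qed.

(** With a and b the averages of g and f, the function a f - b g has average a b - b a = 0. An
    average is a value, so this function vanishes at some [m] of I, and such an [m] is the mean. *)
Lemma gmean_spec x y : I x -> I y ->
  I (M x y) /\
  f (M x y) * segment_mean g x y = g (M x y) * segment_mean f x y.
Proof.
move=> Ix Iy.
set a := segment_mean g x y; set b := segment_mean f x y.
have ch : continuous_on (fun z => a * f z + (- b) * g z).
  move=> z Iz; apply: continuousD; apply: continuousM;
    first [exact: cvg_cst|exact: cf|exact: cg].
have [m Im] := segment_mean_value ch Ix Iy.
rewrite segment_mean_linear// -/a -/b => E.
have {}E : f m * a = g m * b by lra.
by rewrite (gmean_eq Ix Iy Im E).
Qed.

End mean_values.

(** * Differentiation of averages under the integral sign *)

Section moments.
Variables (R : realType) (I : set R) (x e : R).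
Hypotheses (I_itv : is_interval I) (I_open : open I).
Hypothesis e_gt0 : 0 < e.
Hypothesis xI : forall y, `|y - x| < e -> I y.
Implicit Types (f g h : R -> R) (u t : R) (k n : nat).
Notation leb := (@lebesgue_measure R).
Local Notation continuous_on h := (forall z, I z -> {for z, continuous h}).
Local Notation N := (`]- e, e[%classic : set R).

(** Every derivative in [u] of the average of h over the segment with centre [c] and endpoints
    [c - u / 2], [c + u / 2] brings out one more factor t - 1/2; hence the weights. *)
Definition moment_mean k h (c u : R) :=
  \int[leb]_(t in `[0, 1]) ((t - 2^-1) ^+ k * h (c + (t - 2^-1) * u)).

Let norm_half t : t \in `[0, 1]%R -> `|t - 2^-1| <= 2^-1.
Proof. by rewrite in_itv/= ler_norml => /andP[t0 t1]; apply/andP; split; lra. Qed.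

Let ballE u : N u = (`|u| < e) :> Prop.
Proof. by rewrite set_itvE/= ltr_norml. Qed.

Let point_near u t : t \in `[0, 1]%R -> N u -> `|x + (t - 2^-1) * u - x| <= e / 2.
Proof.
move=> /norm_half t01; rewrite ballE => ue.
rewrite addrAC subrr add0r normrM mulrC; apply: ler_pM => //; exact: ltW.
Qed.

Let near_I y : `|y - x| <= e / 2 -> I y.
Proof. by move=> yx; apply: xI; apply: le_lt_trans yx _; have := e_gt0; lra. Qed.

Let point_I u t : t \in `[0, 1]%R -> N u -> I (x + (t - 2^-1) * u).
Proof. by move=> t01 Nu; exact/near_I/point_near. Qed.

Let continuous_integrand k h u : continuous_on h -> N u ->
  {within `[0, 1], continuous (fun t => (t - 2^-1) ^+ k * h (x + (t - 2^-1) * u))}.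
Proof.
move=> ch Nu; apply: continuous_in_subspaceT => t /set_mem /= t01.
apply: (continuousME (f := fun t => (t - 2^-1) ^+ k)).
  by apply: is_derive_continuous; derive_by reflexivity.
apply: (continuous_compE (f := fun t => x + (t - 2^-1) * u)).
  by apply: is_derive_continuous; derive_by reflexivity.
by apply: ch; exact: point_I.
Qed.

Let integrable_integrand k h u : continuous_on h -> N u ->
  leb.-integrable `[0, 1] (EFin \o (fun t => (t - 2^-1) ^+ k * h (x + (t - 2^-1) * u))).
Proof. by move=> ch Nu; exact/continuous_integrable/continuous_integrand. Qed.

(** For |u| < e the points stay in the compact interval [x - e/2, x + e/2], where |h| attains a
    maximum, and the weight is at most 1 in absolute value. The bound is uniform in [u], so it
    serves as the dominating function below. *)
Let bounded_integrand k h : continuous_on h -> exists2 C : R, 0 <= C &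
  forall u t, N u -> `[0, 1]%classic t ->
    `|(t - 2^-1) ^+ k * h (x + (t - 2^-1) * u)| <= C.
Proof.
move=> ch.
have xle : x - e / 2 <= x + e / 2 by have := e_gt0; lra.
have Ie y : x - e / 2 <= y <= x + e / 2 -> I y.
  by move=> /andP[y1 y2]; apply: near_I; rewrite ler_norml; apply/andP; split; lra.
have [|c _ hc] := @EVT_max _ (fun z => `|h z|) _ _ xle.
  apply: (continuous_within I_itv (h := fun z => `|h z|)).
  - by move=> z Iz; apply: continuous_compE; [exact: ch|exact: norm_continuous].
  - by apply: Ie; rewrite lexx.
  - by apply: Ie; rewrite lexx andbT.
exists `|h c| => // u t Nu t01; rewrite normrM -[leRHS]mul1r; apply: ler_pM => //.
  rewrite normrX exprn_ile1// (le_trans (norm_half _))// invf_le1//; lra.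
by apply: hc; rewrite in_itv/= -ler_distl; exact: point_near.
Qed.

Lemma moment_mean_continuous k h u : continuous_on h -> N u ->
  {for u, continuous (moment_mean k h x)}.
Proof.
move=> ch Nu; have [C C0 hC] := bounded_integrand k ch.
apply: (@continuity_under_integral _ _ _ leb
  (fun u t => (t - 2^-1) ^+ k * h (x + (t - 2^-1) * u)) _ _ (- e) e _ _ (fun=> C)).
- exact: measurable_itv.
- by move=> v Nv; exact: integrable_integrand.
- apply: aeW => t t01 v /set_mem Nv.
  apply: (continuousME (f := fun=> (t - 2^-1) ^+ k)); first exact: cvg_cst.
  apply: (continuous_compE (f := fun v => x + (t - 2^-1) * v)).
    by apply: is_derive_continuous; derive_by reflexivity.
  by apply: ch; exact: point_I.
- by apply: continuous_integrable; apply: continuous_subspaceT => z; exact: cvg_cst.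
- by move=> v Nv; apply: aeW => t t01; exact: hC.
- by rewrite inE.
Qed.

Lemma is_derive_moment_mean k h h' u : (forall z, I z -> is_derive z 1 h (h' z)) ->
  continuous_on h' -> N u ->
  is_derive u 1 (moment_mean k h x) (moment_mean k.+1 h' x u).
Proof.
move=> hh' ch' Nu; have [C C0 hC] := bounded_integrand k.+1 ch'.
have ch : continuous_on h by move=> z /hh'; exact: is_derive_continuous.
pose F (u t : R) := (t - 2^-1) ^+ k * h (x + (t - 2^-1) * u).
have dF v t : N v -> `[0, 1]%classic t ->
    is_derive v 1 (F ^~ t) ((t - 2^-1) ^+ k.+1 * h' (x + (t - 2^-1) * v)).
  move=> Nv t01; notypeclasses refine (is_derive_rew _ _).
    notypeclasses refine (is_deriveME _ _); first exact: is_derive_cstE.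
    derive_comp; first by apply: hh'; exact: point_I.
    by repeat derive_step.
  by rewrite exprS; ring.
have intF v : N v -> leb.-integrable `[0, 1] (EFin \o F v).
  by move=> Nv; exact: integrable_integrand.
have derF v t : N v -> `[0, 1]%classic t -> derivable (F ^~ t) v 1.
  by move=> Nv /(dF _ _ Nv); exact: is_derive_derivable.
have intC : leb.-integrable `[0, 1] (EFin \o (fun=> C : R)).
  by apply: continuous_integrable; apply: continuous_subspaceT => z; exact: cvg_cst.
have ubF v t : N v -> `[0, 1]%classic t -> `|partial1of2 F v t| <= C.
  by move=> Nv t01; rewrite /partial1of2 (is_derive_val (dF v t Nv t01)); exact: hC.
have mB : measurable (`[0, 1]%classic : set (measurableTypeR R)).
  exact: measurable_itv.
have E := differentiation_under_integral (mu := leb) mB Nu intF derF (fun=> C0) intC ubF.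
have D := derivable_under_integral (mu := leb) mB Nu intF derF (fun=> C0) intC ubF.
have := derivable_is_derive D; rewrite E => /is_derive_rew; apply.
apply: eq_Rintegral => t /set_mem t01.
by rewrite /partial1of2 (is_derive_val (dF u t Nu t01)).
Qed.

Lemma Cn_moment_mean n k h : Cn n I h -> Cn n N (moment_mean k h x).
Proof.
elim: n k h => [|n ih] k h ch.
  by apply: Cn0 => u; apply: moment_mean_continuous => z; exact: (Cn_continuous ch).
apply: (@Cn_is_deriveS _ _ _ _ _ (moment_mean k.+1 (derive1 h) x)).
- exact: interval_open.
- move=> u; apply: is_derive_moment_mean => z.
    exact: (Cn_is_derive _ ch).
  by case/CnS: ch => _ ch; exact: (Cn_continuous ch).
- by apply: ih; case/CnS: ch.
Qed.

Lemma derive1n_moment_mean n j k h u : (j <= n)%N -> Cn n I h -> N u ->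
  derive1n j (moment_mean k h x) u = moment_mean (j + k) (derive1n j h) x u.
Proof.
move=> + ch; elim: j u => [//|j ih] u jn Nu; rewrite derive1nS.
have Nopen : open N by exact: interval_open.
rewrite (near_eq_derive1 (g := moment_mean (j + k) (derive1n j h) x)).
  apply: is_derive_val; apply: is_derive_moment_mean => // z Iz.
    exact: (Cn_is_derive1n jn ch).
  have : Cn (j.+1 + (n - j.+1)) I h by rewrite subnKC.
  by move=> /Cn_derive1n /Cn_continuous; exact.
by near=> v; apply: ih; [exact: ltnW|near: v; exact: (near_open Nopen Nu)].
Unshelve. all: by end_near. Qed.

End moments.

Section centered_moments.
Variable R : realType.
Notation leb := (@lebesgue_measure R).

(** The factor is the central moment of order [k] of the uniform law: 1, 1/12, 1/80, 1/448 for k =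
    0, 2, 4, 6. *)
Lemma moment_mean0 k (h : R -> R) (x : R) : moment_mean k h x 0 =
  h x * ((2^-1 ^+ k.+1 - (- 2^-1) ^+ k.+1) / k.+1%:R).
Proof.
rewrite /moment_mean; under eq_Rintegral do rewrite mulr0 addr0.
apply: etrans; first apply: (Rintegral_is_derive
  (H := fun t => (t - 2^-1) ^+ k.+1 / k.+1%:R * h x) ler01).
- move=> t _; derive_by ltac:(rewrite /=; field).
  by rewrite addrC natr1 pnatr_eq0.
- by apply: continuous_subspaceT => t; apply: is_derive_continuous; derive_by reflexivity.
- by rewrite /= sub0r (_ : 1 - 2^-1 = 2^-1 :> R); [ring|lra].
Qed.

Lemma segment_mean_moment (h : R -> R) x u :
  segment_mean h (x + u / 2) (x - u / 2) = moment_mean 0 h x u.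
Proof.
apply: eq_Rintegral => t _; rewrite expr0 mul1r; congr h.
by field.
Qed.

End centered_moments.

(** * Expansions at 0 *)

Section jets.
Variable R : realType.
Implicit Types (a b : R -> R) (u c d k : R) (n : nat).

(** This is a = o(u^n) at 0. The point u = 0 is included, so that a 0 = 0 is part of it, for n = 0
    too because eps is arbitrary. *)
Definition negligible n a :=
  forall eps : R, 0 < eps -> \forall u \near (0 : R), `|a u| <= eps * `|u| ^+ n.

Lemma near0W (P : R -> Prop) : (forall u, P u) -> \forall u \near (0 : R), P u.
Proof. by move=> allP; near=> u; exact: allP. Unshelve. all: by end_near. Qed.

Lemma near0_le c : 0 < c -> \forall u \near (0 : R), `|u| <= c.
Proof.
by move=> c0; apply/nbhs_ballP; exists c => // u; rewrite /ball/= sub0r normrN => /ltW.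
Qed.

Lemma negligible_near n a b : (\forall u \near (0 : R), a u = b u) ->
  negligible n a -> negligible n b.
Proof.
move=> ab na eps eps0; near=> u.
have <- : a u = b u by near: u.
by near: u; exact: (na _ eps0).
Unshelve. all: by end_near. Qed.

Lemma eq_negligible n a b : (forall u, a u = b u) -> negligible n a -> negligible n b.
Proof. by move=> ab; apply: negligible_near; exact: near0W. Qed.

Lemma negligible0 n : negligible n (fun=> 0).
Proof.
by move=> eps eps0; apply: near0W => u; rewrite normr0 mulr_ge0// ?exprn_ge0// ltW.
Qed.

Lemma negligibleD n a b : negligible n a -> negligible n b ->
  negligible n (fun u => a u + b u).
Proof.
move=> na nb eps eps0; have eps2 : 0 < eps / 2 by lra.
near=> u; apply: le_trans (ler_normD _ _) _.
have au : `|a u| <= eps / 2 * `|u| ^+ n by near: u; exact: (na _ eps2).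
have bu : `|b u| <= eps / 2 * `|u| ^+ n by near: u; exact: (nb _ eps2).
by apply: le_trans (lerD au bu) _; rewrite -mulrDl -splitr.
Unshelve. all: by end_near. Qed.

Lemma negligibleMl n a b c : (\forall u \near (0 : R), `|b u| <= c) ->
  negligible n a -> negligible n (fun u => b u * a u).
Proof.
move=> bc na eps eps0; pose C := `|c| + 1.
have C0 : 0 < C by rewrite /C; have := normr_ge0 c; lra.
near=> u; rewrite normrM.
have au : `|a u| <= eps / C * `|u| ^+ n by near: u; exact: (na _ (divr_gt0 eps0 C0)).
have bu : `|b u| <= C.
  have : `|b u| <= c by near: u.
  by rewrite /C; have := ler_norm c; lra.
by apply: le_trans (ler_pM _ _ bu au) _ => //; rewrite mulrA mulrCA divff ?mulr1 ?gt_eqF.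
Unshelve. all: by end_near. Qed.

Lemma negligibleW m n a : (m <= n)%N -> negligible n a -> negligible m a.
Proof.
move=> mn na eps eps0; near=> u.
have au : `|a u| <= eps * `|u| ^+ n by near: u; exact: (na _ eps0).
have u1 : `|u| <= 1 by near: u; exact: (near0_le ltr01).
apply: le_trans au _; apply: ler_wpM2l; first exact: ltW.
exact: ler_wiXn2l.
Unshelve. all: by end_near. Qed.

Lemma negligible_pow n a c : (\forall u \near (0 : R), `|a u| <= c) ->
  negligible n (fun u => u ^+ n.+1 * a u).
Proof.
move=> ac.
apply: (@eq_negligible _ (fun u => a u * u ^+ n.+1)) => [u|]; first by rewrite mulrC.
apply: negligibleMl ac _ => eps eps0; near=> u.
rewrite normrX exprS; apply: ler_wpM2r; first exact: exprn_ge0.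
by near: u; exact: (near0_le eps0).
Unshelve. all: by end_near. Qed.

Lemma near0_bounded a : {for (0 : R), continuous a} ->
  \forall u \near (0 : R), `|a u| <= `|a 0| + 1.
Proof.
move=> ca; near=> u.
have au : `|a 0 - a u| < 1.
  by near: u; move/cvgrPdist_lt : ca => /(_ 1 ltr01).
have := ler_normB (a 0) (a 0 - a u); rewrite opprB addrCA subrr addr0; lra.
Unshelve. all: by end_near. Qed.

(** Uniqueness of expansions, one coefficient at a time: u^(n+1) a(u) is itself o(u^n), so c u^n is
    o(u^n) as well, and for c != 0 a single point contradicts this with eps = |c| / 2. *)
Lemma negligible_lead n c a : {for (0 : R), continuous a} ->
  negligible n (fun u => u ^+ n * (c + u * a u)) -> c = 0.
Proof.
move=> ca nc; apply/eqP; rewrite -normr_eq0; apply/negP => /negP c0.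
have {}c0 : 0 < `|c| by rewrite lt_neqAle eq_sym c0 normr_ge0.
have na : negligible n (fun u => u ^+ n * c).
  have := negligibleD nc (negligible_pow n (near0_bounded (continuousN ca))).
  by apply: eq_negligible => u /=; rewrite exprSr; ring.
have /na/nbhs_ballP[e /= e0 he] : 0 < `|c| / 2 by lra.
have /he : ball 0 e (e / 2) by rewrite /ball /= sub0r normrN gtr0_norm; lra.
rewrite normrM normrX mulrC (ger0_norm (_ : 0 <= e / 2)); last lra.
rewrite ler_pM2r; first lra.
by apply: exprn_gt0; lra.
Qed.

(* Only even powers occur: the mean and the averages are even functions of the
   displacement [u]. *)
Definition jet a c0 c1 c2 c3 :=
  negligible 6 (fun u => a u - (c0 + c1 * u ^+ 2 + c2 * u ^+ 4 + c3 * u ^+ 6)).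

Lemma poly_continuous c0 c1 c2 c3 :
  {for (0 : R), continuous (fun u : R => c0 + c1 * u ^+ 2 + c2 * u ^+ 4 + c3 * u ^+ 6)}.
Proof. by apply: is_derive_continuous; derive_by reflexivity. Qed.

Lemma jet_bounded a c0 c1 c2 c3 : jet a c0 c1 c2 c3 ->
  \forall u \near (0 : R), `|a u| <= `|c0| + 2.
Proof.
move=> ja; have b := near0_bounded (@poly_continuous c0 c1 c2 c3).
near=> u.
have : `|c0 + c1 * u ^+ 2 + c2 * u ^+ 4 + c3 * u ^+ 6| <= `|c0| + 1.
  by near: u; apply: filterS b => u; rewrite !expr0n !mulr0 !addr0.
have : `|a u - (c0 + c1 * u ^+ 2 + c2 * u ^+ 4 + c3 * u ^+ 6)| <= 1 * `|u| ^+ 0.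
  by near: u; apply: (negligibleW _ ja).
rewrite expr0 mulr1; set p := _ + c3 * _ => h1 h2.
by have := ler_normD (a u - p) p; rewrite subrK; lra.
Unshelve. all: by end_near. Qed.

Lemma jet_cst c : jet (fun=> c) c 0 0 0.
Proof. by apply: eq_negligible (negligible0 6) => u /=; ring. Qed.

Lemma jetD a b c0 c1 c2 c3 d0 d1 d2 d3 : jet a c0 c1 c2 c3 -> jet b d0 d1 d2 d3 ->
  jet (fun u => a u + b u) (c0 + d0) (c1 + d1) (c2 + d2) (c3 + d3).
Proof. by move=> ja jb; apply: eq_negligible (negligibleD ja jb) => u /=; ring. Qed.

Lemma jetM a b c0 c1 c2 c3 d0 d1 d2 d3 : jet a c0 c1 c2 c3 -> jet b d0 d1 d2 d3 ->
  jet (fun u => a u * b u) (c0 * d0) (c0 * d1 + c1 * d0)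
    (c0 * d2 + c1 * d1 + c2 * d0) (c0 * d3 + c1 * d2 + c2 * d1 + c3 * d0).
Proof.
move=> ja jb.
pose p u := c0 + c1 * u ^+ 2 + c2 * u ^+ 4 + c3 * u ^+ 6.
have pb := near0_bounded (@poly_continuous c0 c1 c2 c3).
(* [u ^+ 7 * q u] gathers the terms of degree 8, 10 and 12 of the product of the two polynomials. *)
pose q u := u * ((c1 * d3 + c2 * d2 + c3 * d1)
                 + (c2 * d3 + c3 * d2) * u ^+ 2 + c3 * d3 * u ^+ 4).
have cq : {for (0 : R), continuous q} by apply: is_derive_continuous; derive_by reflexivity.
have n1 := negligibleMl pb jb.
have n2 := negligibleMl (jet_bounded jb) ja.
have n3 := negligible_pow 6 (near0_bounded cq).
apply: eq_negligible (negligibleD (negligibleD n1 n2) n3) => u /=.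
by rewrite /q; ring.
Qed.

Lemma jetZ k a c0 c1 c2 c3 : jet a c0 c1 c2 c3 ->
  jet (fun u => k * a u) (k * c0) (k * c1) (k * c2) (k * c3).
Proof.
move=> ja; have := jetM (jet_cst k) ja.
by rewrite !mul0r !addr0.
Qed.

Lemma jet_eq0 a c0 c1 c2 c3 : (\forall u \near (0 : R), a u = 0) -> jet a c0 c1 c2 c3 ->
  [/\ c0 = 0, c1 = 0, c2 = 0 & c3 = 0].
Proof.
move=> a_0 ja.
have {a_0}np : negligible 6 (fun u : R => c0 + c1 * u ^+ 2 + c2 * u ^+ 4 + c3 * u ^+ 6).
  have b1 : \forall u \near (0 : R), `|(-1 : R)| <= 1.
    by apply: near0W => u; rewrite normrN1.
  apply: negligible_near (negligibleMl (b := fun=> -1) b1 ja); near=> u.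
  have au : a u = 0 by near: u.
  by rewrite au; ring.
have cont d1 d2 d3 : {for (0 : R), continuous (fun u : R => d1 * u + d2 * u ^+ 3 + d3 * u ^+ 5)}.
  by apply: is_derive_continuous; derive_by reflexivity.
have c0E : c0 = 0.
  apply: (negligible_lead (n := 0) (cont c1 c2 c3)).
  by apply: eq_negligible (negligibleW (leq0n 6) np) => u /=; ring.
have c1E : c1 = 0.
  apply: (negligible_lead (n := 2) (cont c2 c3 0)).
  by apply: eq_negligible (negligibleW (_ : 2 <= 6)%N np) => // u /=; rewrite c0E; ring.
have c2E : c2 = 0.
  apply: (negligible_lead (n := 4) (cont c3 0 0)).
  by apply: eq_negligible (negligibleW (_ : 4 <= 6)%N np) => // u /=; rewrite c0E c1E; ring.
have c3E : c3 = 0.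
  apply: (negligible_lead (n := 6) (cont 0 0 0)).
  by apply: eq_negligible np => u /=; rewrite c0E c1E c2E; ring.
by [].
Unshelve. all: by end_near. Qed.

End jets.

(** * Taylor expansions with Peano remainder and their composition *)

Section taylor.
Variables (R : realType) (N : set R).
Hypotheses (N_itv : is_interval N) (N_open : open N).
Implicit Types (a h k : R -> R) (x y : R) (n : nat).

Lemma MVT_norm h k x y : (forall z, N z -> is_derive z 1 h (k z)) -> N x -> N y ->
  exists z, [/\ N z, `|z - x| <= `|y - x| & h y - h x = k z * (y - x)].
Proof.
move=> hk Nx Ny; case: (ltgtP x y) => [xy|yx|<-].
- have [z [Nz /andP[xz zy] E]] := MVT_open N_itv hk Nx Ny xy; exists z; split => //.
  by rewrite !ger0_norm; lra.
- have [z [Nz /andP[yz zx] E]] := MVT_open N_itv hk Ny Nx yx; exists z; split => //.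
    by rewrite !ler0_norm; lra.
  by rewrite -opprB E; ring.
- by exists x; split => //; rewrite !subrr mulr0.
Qed.

End taylor.

Section taylor_young.
Variable R : realType.
Implicit Types (a h k : R -> R) (x y : R) (n : nat) (N : set R).

Lemma is_derive_sum_pow (c : nat -> R) n (u : R) :
  is_derive u 1 (fun v => \sum_(j < n.+1) c j * v ^+ j)
    (\sum_(j < n) c j.+1 * j.+1%:R * u ^+ j).
Proof.
elim: n => [|n ih].
  rewrite big_ord0 (_ : (fun v => _) = fun=> c 0%N); first exact: is_derive_cstE.
  by apply/funext => v; rewrite big_ord1 expr0 mulr1.
rewrite big_ord_recr /= (_ : (fun v => _) =
    fun v => \sum_(j < n.+1) c j * v ^+ j + c n.+1 * v ^+ n.+1); last first.
  by apply/funext => v; rewrite big_ord_recr.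
notypeclasses refine (is_deriveDE ih _); derive_by ltac:(rewrite /=; ring).
Qed.

Lemma is_derive_taylor_poly a x n (u : R) :
  is_derive u 1 (fun u => \sum_(j < n.+2) derive1n j a x / j`!%:R * u ^+ j)
    (\sum_(j < n.+1) derive1n j (derive1 a) x / j`!%:R * u ^+ j).
Proof.
refine (is_derive_rew (is_derive_sum_pow (fun j => derive1n j a x / j`!%:R) n.+1 u) _).
apply: eq_bigr => j _; congr (_ * _).
rewrite derive1Sn factS natrM invfM [_^-1 * _]mulrC mulrA -mulrA mulVf ?mulr1//.
Qed.

(** Induction on the order: the derivative of the remainder is the remainder of [derive1 a] one
    order lower. The mean value theorem from 0, where the remainder vanishes, then gains one factor
    |u|. *)
Lemma taylor_young N n a x : open N -> N x -> Cn n N a ->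
  negligible n (fun u => a (x + u) - \sum_(j < n.+1) derive1n j a x / j`!%:R * u ^+ j).
Proof.
move=> N_open Nx; elim: n a => [|n ih] a ca.
  have cax := Cn_continuous ca Nx.
  move=> eps eps0; have /cvgrPdist_le/(_ _ eps0)/nbhs_ballP[e e0 he] := cax.
  apply/nbhs_ballP; exists e => // u; rewrite /ball/= sub0r normrN => ue.
  rewrite big_ord1 expr0 !mulr1 divr1 distrC; apply: he.
  by rewrite /ball/= opprD addrA subrr sub0r normrN.
have [_ ca'] := (CnS _ _ _).1 ca.
have na' := ih _ ca'.
move=> eps eps0; have /nbhs_ballP[e e0 he] := na' _ eps0.
have [d d0 dN] := open_ball N_open Nx.
pose r := Num.min d e.
have r0 : 0 < r by rewrite lt_min d0.
apply/nbhs_ballP; exists r => // u; rewrite /ball/= sub0r normrN => ur.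
pose b (u : R) := a (x + u) - \sum_(j < n.+2) derive1n j a x / j`!%:R * u ^+ j.
pose db (u : R) := derive1 a (x + u) - \sum_(j < n.+1) derive1n j (derive1 a) x / j`!%:R * u ^+ j.
have bdb z : `]- r, r[%classic z -> is_derive z 1 b (db z).
  rewrite /= in_itv/= -ltr_norml lt_min => /andP[zd _].
  apply: is_deriveDE; last by apply: is_deriveNE; exact: is_derive_taylor_poly.
  notypeclasses refine (is_derive_rew (a := derive1 a (x + z) * (0 + 1)) _ _); last first.
    by rewrite add0r mulr1.
  derive_comp; last by repeat derive_step.
  apply: (Cn_is_derive _ ca) => //; apply: dN.
  by rewrite addrAC subrr add0r.
set J := `]- r, r[%classic in bdb.
have J_itv : is_interval J by exact: interval_is_interval.
have J0 : J 0 by rewrite /J/= in_itv/= oppr_lt0 r0.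
have Ju : J u by rewrite /J/= in_itv/= -ltr_norml.
have [z [Jz zu]] := MVT_norm J_itv bdb J0 Ju.
have -> : b 0 = 0.
  rewrite /b addr0 big_ord_recl big1 => [|j _]; first by rewrite expr0 fact0 divr1 mulr1 addr0 subrr.
  by rewrite /= exprS mul0r mulr0.
rewrite -/(b u) !subr0 => ->; rewrite normrM exprSr mulrA.
apply: ler_wpM2r => //; rewrite !subr0 in zu.
have ze : ball 0 e z.
  rewrite /ball/= sub0r normrN; apply: le_lt_trans zu _; apply: lt_le_trans ur _.
  by rewrite ge_min lexx orbT.
apply: le_trans (he _ ze) _; apply: ler_wpM2l; first exact: ltW.
by apply: lerXn2r => //; rewrite ?nnegrE.
Qed.

(** Averaging the expansions at u and -u cancels the odd terms. *)
Lemma jet_even (e : R) a : 0 < e -> Cn 6 `]- e, e[%classic a ->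
  (forall u, `]- e, e[%classic u -> a (- u) = a u) ->
  jet a (a 0) (derive1n 2 a 0 / 2`!%:R) (derive1n 4 a 0 / 4`!%:R) (derive1n 6 a 0 / 6`!%:R).
Proof.
move=> e0 ca even_a; set J := `]- e, e[%classic in ca even_a.
have J_open : open J by exact: interval_open.
have J0 : J 0 by rewrite /J/= in_itv/= oppr_lt0 e0.
have na := taylor_young J_open J0 ca.
have na' : negligible 6 (fun u => a (0 + - u) - \sum_(j < 7) derive1n j a 0 / j`!%:R * (- u) ^+ j).
  move=> eps eps0; have /nbhs_ballP[d d0 hd] := na _ eps0.
  apply/nbhs_ballP; exists d => // u ud; rewrite -(normrN u).
  by apply: hd; move: ud; rewrite /ball/= !sub0r opprK normrN.
have b2 : \forall u \near (0 : R), `|(2^-1 : R)| <= 1.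
  by apply: near0W => u; rewrite ger0_norm; lra.
have even_part (q : nat -> R) u A :
    2^-1 * ((A - \sum_(j < 7) q j * u ^+ j) + (A - \sum_(j < 7) q j * (- u) ^+ j)) =
    A - (q 0%N + q 2%N * u ^+ 2 + q 4%N * u ^+ 4 + q 6%N * u ^+ 6).
  by rewrite !big_ord_recl !big_ord0 /= /bump /= !add1n; field.
have := negligibleMl (b := fun=> 2^-1) b2 (negligibleD na na').
apply: negligible_near; near=> u.
have Ju : J u by near: u; exact: near_open.
rewrite !add0r (even_a _ Ju).
by rewrite (even_part (fun j => derive1n j a 0 / j`!%:R)) fact0 divr1.
Unshelve. all: by end_near. Qed.

Lemma jet0_bound a (c1 c2 c3 : R) : jet a 0 c1 c2 c3 ->
  exists2 c, 0 < c & \forall u \near (0 : R), `|a u| <= c * `|u| ^+ 2.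
Proof.
move=> ja; exists (`|c1| + 2); first by have := normr_ge0 c1; lra.
have cq : {for (0 : R), continuous (fun u : R => c1 + c2 * u ^+ 2 + c3 * u ^+ 4)}.
  by apply: is_derive_continuous; derive_by reflexivity.
have bq := near0_bounded cq.
near=> u.
have h1 : `|a u - (0 + c1 * u ^+ 2 + c2 * u ^+ 4 + c3 * u ^+ 6)| <= 1 * `|u| ^+ 2.
  by near: u; exact: (negligibleW (_ : 2 <= 6)%N ja).
have h2 : `|c1 + c2 * u ^+ 2 + c3 * u ^+ 4| <= `|c1| + 1.
  by near: u; apply: filterS bq => u; rewrite !expr0n !mulr0 !addr0.
have -> : a u = (a u - (0 + c1 * u ^+ 2 + c2 * u ^+ 4 + c3 * u ^+ 6))
   + (c1 + c2 * u ^+ 2 + c3 * u ^+ 4) * u ^+ 2 by ring.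
apply: le_trans (ler_normD _ _) _; rewrite normrM normrX.
have := ler_wpM2r (exprn_ge0 2 (normr_ge0 u)) h2; lra.
Unshelve. all: by end_near. Qed.

(** As a = O(u^2), the remainder o(a^3) of the third-order expansion of f is already o(u^6); what
    remains is algebra of jets. *)
Lemma jet_comp (I : set R) f x a (c1 c2 c3 : R) : open I -> I x -> Cn 3 I f ->
  jet a 0 c1 c2 c3 ->
  jet (fun u => f (x + a u)) (f x) (derive1n 1 f x * c1)
    (derive1n 1 f x * c2 + derive1n 2 f x / 2 * c1 ^+ 2)
    (derive1n 1 f x * c3 + derive1n 2 f x * c1 * c2 + derive1n 3 f x / 6 * c1 ^+ 3).
Proof.
move=> I_open Ix cf ja; have [c c0 ac] := jet0_bound ja.
have nr := taylor_young I_open Ix cf.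
set r := fun u => f (x + u) - _ in nr.
have nra : negligible 6 (fun u => r (a u)).
  move=> eps eps0.
  (* The factor 1 / c^3 absorbs the cube of the bound |a u| <= c |u|^2. *)
  have /nr/nbhs_ballP[d d0 hd] : 0 < eps / c ^+ 3 by rewrite divr_gt0// exprn_gt0.
  have {}d0 : 0 < d by [].
  near=> u.
  have au : `|a u| <= c * `|u| ^+ 2 by near: u.
  have u1 : `|u| <= 1 by near: u; exact: (near0_le ltr01).
  have ud : `|u| <= d / c / 2 by near: u; apply: near0_le; rewrite !divr_gt0.
  have aud : `|a u| < d.
    apply: le_lt_trans au _; apply: (@le_lt_trans _ _ (c * `|u|)).
      rewrite ler_pM2l// expr2 -[leRHS]mulr1; exact: ler_wpM2l.
    apply: (@le_lt_trans _ _ (c * (d / c / 2))); first by rewrite ler_pM2l.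
    by rewrite (_ : c * (d / c / 2) = d / 2); [lra|field; rewrite gt_eqF].
  have /hd : ball 0 d (a u) by rewrite /ball/= sub0r normrN.
  move=> /le_trans; apply.
  rewrite -mulrA; apply: ler_wpM2l; first exact: ltW.
  rewrite -(ler_pM2l (exprn_gt0 3 c0)) mulrA mulfV ?mul1r ?expf_neq0 ?gt_eqF//.
  by rewrite (exprM _ 2 3) -exprMn lerXn2r// nnegrE// mulr_ge0// ?exprn_ge0// ltW.
have j2 := jetM ja ja; have j3 := jetM ja j2.
have := jetD (jetD (jetD (jet_cst (f x)) (jetZ (derive1n 1 f x) ja))
   (jetZ (derive1n 2 f x / 2) j2)) (jetZ (derive1n 3 f x / 6) j3).
move=> /(negligibleD nra); apply: eq_negligible => u.
have sum4 (q : nat -> R) v : \sum_(j < 4) q j * v ^+ j =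
    q 0%N + q 1%N * v + q 2%N * v ^+ 2 + q 3%N * v ^+ 3.
  by rewrite !big_ord_recl big_ord0 /= /bump /= !add1n; ring.
have q0 : derive1n 0 f x / 0`!%:R = f x by rewrite fact0 divr1.
have q1 : derive1n 1 f x / 1`!%:R = derive1n 1 f x by rewrite (_ : 1`! = 1%N)// divr1.
have q2 : derive1n 2 f x / 2`!%:R = derive1n 2 f x / 2 by [].
have q3 : derive1n 3 f x / 3`!%:R = derive1n 3 f x / 6 by [].
have taylor3 v : \sum_(j < 4) derive1n j f x / j`!%:R * v ^+ j =
    f x + derive1n 1 f x * v + derive1n 2 f x / 2 * v ^+ 2 + derive1n 3 f x / 6 * v ^+ 3.
  apply: etrans (sum4 (fun j => derive1n j f x / j`!%:R) v) _.
  congr (_ + _ * _ + _ * _ + _ * _); [exact: q0|exact: q1].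
rewrite /r taylor3.
set f1 := derive1n 1 f x; set f2 := derive1n 2 f x; set f3 := derive1n 3 f x.
by clearbody f1 f2 f3; move: (a u) => v; field.
Unshelve. all: by end_near. Qed.

End taylor_young.

(** * The mean near the diagonal *)

Section quotient.
Variables (R : realType) (I : set R) (f g : R -> R) (n : nat).
Hypotheses (I_itv : is_interval I) (I_open : open I) (fgC : Cn_pair n.+1 I f g).
Implicit Types x : R.

Let cf : Cn n.+1 I f. Proof. by case: fgC. Qed.
Let cg : Cn n.+1 I g. Proof. by case: fgC. Qed.

Lemma pair_gt0 x : I x -> 0 < g x. Proof. by case: fgC => _ _ + _; exact. Qed.

Lemma W10_neq0 x : I x -> W 1 0 f g x != 0. Proof. by case: fgC => _ _ _; exact. Qed.

Lemma Cn_W m i j k : (m + i <= k)%N -> (m + j <= k)%N ->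
  Cn k I f -> Cn k I g -> Cn m I (W i j f g).
Proof.
move=> mi mj cfk cgk.
have cd l h : (m + l <= k)%N -> Cn k I h -> Cn m I (derive1n l h).
  by move=> ml ch; apply: Cn_derive1n; rewrite addnC; exact: Cn_leq ch.
by apply: CnB => //; apply: CnM => //; apply: cd.
Qed.

Lemma is_derive_quotient x : I x ->
  is_derive x 1 (fun z => f z / g z) (W 1 0 f g x / g x ^+ 2).
Proof.
move=> Ix; have g0 := pair_gt0 Ix.
have df := Cn_is_derive (ltn0Sn n) cf Ix.
have dg := Cn_is_derive (ltn0Sn n) cg Ix.
have dgV := is_deriveVE (lt0r_neq0 g0) dg.
apply: is_derive_rew (is_deriveME df dgV) _.
by rewrite /W /=; field; rewrite gt_eqF.
Qed.

Lemma Cn_quotient_derive : Cn n I (fun x => W 1 0 f g x / g x ^+ 2).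
Proof.
apply: CnM => //; first by apply: (Cn_W (k := n.+1)); rewrite ?addn1 ?addn0 ?leqnSn.
apply: CnV => //; first by move=> x Ix; rewrite expf_neq0// gt_eqF// pair_gt0.
by apply: (Cn_ext I_open (f := fun x => g x * g x)) => // ; apply: CnM => //; exact: CnW.
Qed.

Lemma quotient_derive_neq0 x : I x -> W 1 0 f g x / g x ^+ 2 != 0.
Proof.
by move=> Ix; rewrite mulf_neq0 ?W10_neq0// invr_neq0// expf_neq0// gt_eqF// pair_gt0.
Qed.

Lemma quotient_inj : {in I &, injective (fun z => f z / g z)}.
Proof.
apply: strictly_monotone_inj.
apply: (derive_neq0_strictly_monotone I_itv is_derive_quotient).
  by move=> x; exact: (Cn_continuous Cn_quotient_derive).
exact: quotient_derive_neq0.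
Qed.

End quotient.

Lemma eq_jet (R : realType) (a : R -> R) (c0 c1 c2 c3 d0 d1 d2 d3 : R) :
  c0 = d0 -> c1 = d1 -> c2 = d2 -> c3 = d3 -> jet a c0 c1 c2 c3 -> jet a d0 d1 d2 d3.
Proof. by move=> -> -> -> ->. Qed.

Section diagonal_mean.
Variables (R : realType) (I : set R) (f g : R -> R) (x e : R).
Hypotheses (I_itv : is_interval I) (I_open : open I) (fgC6 : Cn_pair 6 I f g).
Hypotheses (Ix : I x) (e_gt0 : 0 < e) (xI : forall y, `|y - x| < e -> I y).
Local Notation N := (`]- e, e[%classic : set R).
Local Notation m := (gmean_diag I f g (@lebesgue01 R) x).

Let cf : Cn 6 I f. Proof. by case: fgC6. Qed.
Let cg : Cn 6 I g. Proof. by case: fgC6. Qed.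
Let f_cont : forall z, I z -> {for z, continuous f}.
Proof. by move=> z; exact: (Cn_continuous cf). Qed.
Let g_cont : forall z, I z -> {for z, continuous g}.
Proof. by move=> z; exact: (Cn_continuous cg). Qed.

Lemma moment1_lebesgue01 : moment1 (@lebesgue01 R) = 2^-1.
Proof.
rewrite /moment1 Rintegral_lebesgue01.
apply: etrans; first apply: (Rintegral_is_derive (H := fun t => t ^+ 2 / 2) ler01).
- by move=> t _; derive_by ltac:(rewrite /=; field).
- by apply: continuous_subspaceT => t; apply: is_derive_continuous; derive_by reflexivity.
- by rewrite /= expr1n expr0n mul1r mul0r subr0.
Qed.

Lemma gmean_diagE u : m u = gmean I f g (@lebesgue01 R) (x + u / 2) (x - u / 2).
Proof. by rewrite /gmean_diag moment1_lebesgue01 (_ : 1 - 2^-1 = 2^-1 :> R) ?[2^-1 * u]mulrC//; lra. Qed.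

Let N_I u : N u -> I (x + u / 2) /\ I (x - u / 2).
Proof.
rewrite /= in_itv/= -ltr_norml => ue; split; apply: xI.
all: rewrite addrAC subrr add0r ?normrN normrM (ger0_norm (_ : 0 <= 2^-1)) ?invr_ge0//.
all: by have := normr_ge0 u; lra.
Qed.

Let moment_gt0 u : N u -> 0 < moment_mean 0 g x u.
Proof.
move=> /N_I[I1 I2]; rewrite -segment_mean_moment.
by apply: (segment_mean_gt0 I_itv I_open) => // z; exact: (pair_gt0 fgC6).
Qed.

Lemma gmean_diag_spec u : N u -> I (m u) /\
  f (m u) * moment_mean 0 g x u = g (m u) * moment_mean 0 f x u.
Proof.
move=> /N_I[I1 I2]; rewrite gmean_diagE -!segment_mean_moment.
apply: gmean_spec => //; first by move=> z; exact: (pair_gt0 fgC6).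
exact: (quotient_inj I_itv I_open fgC6).
Qed.

Let Nopen : open N. Proof. exact: interval_open. Qed.
Let N0 : N 0. Proof. by rewrite /= in_itv/= oppr_lt0 e_gt0. Qed.

Lemma gmean_diag0 : m 0 = x.
Proof.
rewrite gmean_diagE mul0r subr0 addr0.
apply: (gmean_eq I_itv I_open) => //.
- by move=> z; exact: (pair_gt0 fgC6).
- exact: (quotient_inj I_itv I_open fgC6).
- by rewrite !segment_mean_diag mulrC.
Qed.

Lemma gmean_diagN u : N u -> m (- u) = m u.
Proof.
move=> /N_I[I1 I2]; rewrite !gmean_diagE mulNr opprK !gmeanE.
by congr (inv_on _ _ (_ / _)); exact: (segment_meanC I_itv I_open).
Qed.

Local Notation K := (fun u => moment_mean 0 f x u / moment_mean 0 g x u).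

Let CnK : Cn 6 N K.
Proof.
apply: CnM => //; first exact: (Cn_moment_mean I_itv e_gt0 xI 0 cf).
apply: CnV => //; first by move=> u Nu; rewrite gt_eqF// moment_gt0.
exact: (Cn_moment_mean I_itv e_gt0 xI 0 cg).
Qed.

Let dm u : N u -> is_derive u 1 m
  ((W 1 0 f g (m u) / g (m u) ^+ 2)^-1 * derive1 K u).
Proof.
move=> Nu; have [Im E] := gmean_diag_spec Nu.
have g0 := pair_gt0 fgC6 Im.
have KE : f (m u) / g (m u) = K u.
  by apply/eqP; rewrite eqr_div ?lt0r_neq0// ?moment_gt0// E mulrC.
have dK := Cn_is_derive (ltn0Sn 5) CnK Nu.
have := is_derive_inv_on I_open (quotient_inj I_itv I_open fgC6)
  (is_derive_quotient fgC6) Im (quotient_derive_neq0 fgC6 Im).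
rewrite KE => dinv; have := is_derive_compE (g := K) dinv dK.
apply: is_derive_near; apply: filterS (near_open Nopen Nu) => v Nv.
by rewrite gmean_diagE gmeanE !segment_mean_moment.
Qed.

(** Bootstrap: [dm] expresses the derivative of the mean through the mean itself and K', so
    regularity of order n gives order n + 1. The quotient derivative and K' are of class C^5, which
    carries this up to order 6. *)
Lemma Cn_gmean_diag : Cn 6 N m.
Proof.
suff H n : (n <= 6)%N -> Cn n N m by exact: H.
elim: n => [|n ih] n6.
  by apply: Cn0 => u /dm; exact: is_derive_continuous.
apply: (Cn_is_deriveS Nopen dm); apply: CnM => //.
- apply: (Cn_comp Nopen (I := I) (f := fun z => (W 1 0 f g z / g z ^+ 2)^-1)).
  + by move=> u /gmean_diag_spec[].
  + apply: CnV => //; first by move=> z; exact: (quotient_derive_neq0 fgC6).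
    exact: (Cn_leq (n := 5) _ (Cn_quotient_derive I_open fgC6)).
  + exact/ih/ltnW.
- by have [_ cK] := (CnS _ _ _).1 CnK; exact: (Cn_leq (n := 5) _ cK).
Qed.

(** The averages are even in [u], and the denominators are those of the central moments 1/12, 1/80,
    1/448 times 2!, 4!, 6!. *)
Let jet_moment h : Cn 6 I h ->
  jet (moment_mean 0 h x) (h x) (derive1n 2 h x / 24)
    (derive1n 4 h x / (80 * 24)) (derive1n 6 h x / (448 * 720)).
Proof.
move=> ch.
have even_h u : N u -> moment_mean 0 h x (- u) = moment_mean 0 h x u.
  move=> /N_I[I1 I2]; rewrite -!segment_mean_moment mulNr opprK.
  apply: (segment_meanC I_itv I_open) => // z; exact: (Cn_continuous ch).
have cm := Cn_moment_mean I_itv e_gt0 xI 0 ch.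
apply: eq_jet (jet_even e_gt0 cm even_h); first by rewrite moment_mean0; field.
- rewrite (derive1n_moment_mean I_itv e_gt0 xI 0 (j := 2) _ ch N0)// moment_mean0.
  by rewrite (_ : 2`! = 2%N)//; field.
- rewrite (derive1n_moment_mean I_itv e_gt0 xI 0 (j := 4) _ ch N0)// moment_mean0.
  by rewrite (_ : 4`! = 24%N)//; field.
- rewrite (derive1n_moment_mean I_itv e_gt0 xI 0 (j := 6) _ ch N0)// moment_mean0.
  by rewrite (_ : 6`! = 720%N)//; field.
Qed.

Let D2 := derive1n 2 m 0 / 2`!%:R.
Let D4 := derive1n 4 m 0 / 4`!%:R.
Let D6 := derive1n 6 m 0 / 6`!%:R.

Let jet_shift : jet (fun u => m u - x) 0 D2 D4 D6.
Proof.
have := jetD (jet_even e_gt0 Cn_gmean_diag gmean_diagN) (jet_cst (- x)).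
by apply: eq_jet; rewrite ?addr0// gmean_diag0 subrr.
Qed.

Let jet_at h : Cn 6 I h ->
  jet (fun u => h (m u)) (h x) (derive1n 1 h x * D2)
    (derive1n 1 h x * D4 + derive1n 2 h x / 2 * D2 ^+ 2)
    (derive1n 1 h x * D6 + derive1n 2 h x * D2 * D4 + derive1n 3 h x / 6 * D2 ^+ 3).
Proof.
move=> ch; have := jet_comp I_open Ix (Cn_leq (_ : 3 <= 6)%N ch) jet_shift.
by move=> /(_ isT); apply: eq_negligible => u; rewrite [x + _]addrC subrK.
Qed.

(** These are the coefficients of u^2, u^4 and u^6 in f(m) J_g - g(m) J_f = 0. By antisymmetry in f
    and g the products of derivatives combine to Wronskians, and the newest coefficient of the mean
    enters linearly, with factor W^{1,0}. *)
Lemma gmean_diag_derivatives :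
  [/\ D2 * W 1 0 f g x = W 2 0 f g x / 24,
      D4 * W 1 0 f g x = W 4 0 f g x / (80 * 24) + D2 / 24 * W 2 1 f g x
                         - D2 ^+ 2 / 2 * W 2 0 f g x &
      D6 * W 1 0 f g x = W 6 0 f g x / (448 * 720) + D2 / (80 * 24) * W 4 1 f g x
        + D4 / 24 * W 2 1 f g x - D2 * D4 * W 2 0 f g x - D2 ^+ 3 / 6 * W 3 0 f g x].
Proof.
have near_zero : \forall u \near (0 : R), f (m u) * moment_mean 0 g x u
    + -1 * (g (m u) * moment_mean 0 f x u) = 0.
  apply: filterS (near_open Nopen N0) => u /gmean_diag_spec[_ ->].
  by rewrite mulN1r subrr.
have [_ E2 E4 E6] := jet_eq0 near_zero (jetD (jetM (jet_at cf) (jet_moment cg))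
  (jetZ (-1) (jetM (jet_at cg) (jet_moment cf)))).
move: E2 E4 E6; rewrite /W !derive1n0; clearbody D2 D4 D6.
move: (derive1n 1 f x) (derive1n 2 f x) (derive1n 3 f x) (derive1n 4 f x) (derive1n 6 f x).
move: (derive1n 1 g x) (derive1n 2 g x) (derive1n 3 g x) (derive1n 4 g x) (derive1n 6 g x).
move: (f x) (g x) => f0 g0 g1 g2 g3 g4 g6 f1 f2 f3 f4 f6 E2 E4 E6; split.
- by apply/eqP; rewrite -subr_eq0 -[X in _ == X]E2; apply/eqP; field.
- by apply/eqP; rewrite -subr_eq0 -[X in _ == X]E4; apply/eqP; field.
- by apply/eqP; rewrite -subr_eq0 -[X in _ == X]E6; apply/eqP; field.
Qed.

End diagonal_mean.

(** * From the derivatives to the differential equation *)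

Section linear_equation.
Variables (R : realType) (I : set R).
Hypothesis I_open : open I.
Implicit Types (h p s : R -> R) (x : R).

(** The tool for differentiating an identity that is known on I only. *)
Lemma is_derive_unique h1 h2 x a b : I x -> (forall z, I z -> h1 z = h2 z) ->
  is_derive x 1 h1 a -> is_derive x 1 h2 b -> a = b.
Proof.
move=> Ix h12 d1 d2; rewrite -(is_derive_val d1) -(is_derive_val d2).
by apply: near_eq_derive1; near=> y; apply: h12; near: y; exact: near_open.
Unshelve. all: by end_near. Qed.

(** The Leibniz rule, one differentiation at a time. The bounds on [k] match a solution of class C^6
    and coefficients of class C^4. *)
Lemma linear_equation_derivatives (H P S : nat -> R -> R) :
  (forall k x, (k < 6)%N -> I x -> is_derive x 1 (H k) (H k.+1 x)) ->
  (forall k x, (k < 4)%N -> I x -> is_derive x 1 (P k) (P k.+1 x)) ->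
  (forall k x, (k < 4)%N -> I x -> is_derive x 1 (S k) (S k.+1 x)) ->
  (forall x, I x -> H 2%N x = P 0%N x * H 1%N x + S 0%N x * H 0%N x) ->
  forall x, I x ->
  [/\ H 3%N x = P 0%N x * H 2%N x + P 1%N x * H 1%N x + S 0%N x * H 1%N x + S 1%N x * H 0%N x,
      H 4%N x = P 0%N x * H 3%N x + 2 * P 1%N x * H 2%N x + P 2%N x * H 1%N x
              + S 0%N x * H 2%N x + 2 * S 1%N x * H 1%N x + S 2%N x * H 0%N x,
      H 5%N x = P 0%N x * H 4%N x + 3 * P 1%N x * H 3%N x + 3 * P 2%N x * H 2%N x + P 3%N x * H 1%N x
              + S 0%N x * H 3%N x + 3 * S 1%N x * H 2%N x + 3 * S 2%N x * H 1%N x + S 3%N x * H 0%N x &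
      H 6%N x = P 0%N x * H 5%N x + 4 * P 1%N x * H 4%N x + 6 * P 2%N x * H 3%N x + 4 * P 3%N x * H 2%N x
              + P 4%N x * H 1%N x + S 0%N x * H 4%N x + 4 * S 1%N x * H 3%N x + 6 * S 2%N x * H 2%N x
              + 4 * S 3%N x * H 1%N x + S 4%N x * H 0%N x].
Proof.
move=> dH dP dS E2.
have E3 x : I x -> H 3%N x = P 0%N x * H 2%N x + P 1%N x * H 1%N x + S 0%N x * H 1%N x + S 1%N x * H 0%N x.
  move=> Ix; apply: (is_derive_unique Ix E2 (dH 2%N x isT Ix)).
  have ? := dH 0%N _ isT Ix; have ? := dP 0%N _ isT Ix; have ? := dS 0%N _ isT Ix.
  by have ? := dH 1%N _ isT Ix; derive_by ltac:(ring).
have E4 x : I x -> H 4%N x = P 0%N x * H 3%N x + 2 * P 1%N x * H 2%N x + P 2%N x * H 1%N x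
              + S 0%N x * H 2%N x + 2 * S 1%N x * H 1%N x + S 2%N x * H 0%N x.
  move=> Ix; apply: (is_derive_unique Ix E3 (dH 3%N x isT Ix)).
  have ? := dH 0%N _ isT Ix; have ? := dP 0%N _ isT Ix; have ? := dS 0%N _ isT Ix.
  have ? := dH 1%N _ isT Ix; have ? := dH 2%N _ isT Ix.
  have ? := dP 1%N _ isT Ix; have ? := dS 1%N _ isT Ix.
  by derive_by ltac:(ring).
have E5 x : I x -> H 5%N x = P 0%N x * H 4%N x + 3 * P 1%N x * H 3%N x + 3 * P 2%N x * H 2%N x + P 3%N x * H 1%N x
              + S 0%N x * H 3%N x + 3 * S 1%N x * H 2%N x + 3 * S 2%N x * H 1%N x + S 3%N x * H 0%N x.
  move=> Ix; apply: (is_derive_unique Ix E4 (dH 4%N x isT Ix)).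
  have ? := dH 0%N _ isT Ix; have ? := dP 0%N _ isT Ix; have ? := dS 0%N _ isT Ix.
  have ? := dH 1%N _ isT Ix; have ? := dH 2%N _ isT Ix; have ? := dH 3%N _ isT Ix.
  have ? := dP 1%N _ isT Ix; have ? := dS 1%N _ isT Ix.
  have ? := dP 2%N _ isT Ix; have ? := dS 2%N _ isT Ix.
  by derive_by ltac:(ring).
move=> x Ix; split; [exact: E3|exact: E4|exact: E5|].
apply: (is_derive_unique Ix E5 (dH 5%N x isT Ix)).
have ? := dH 0%N _ isT Ix; have ? := dP 0%N _ isT Ix; have ? := dS 0%N _ isT Ix.
have ? := dH 1%N _ isT Ix; have ? := dH 2%N _ isT Ix; have ? := dH 3%N _ isT Ix.
have ? := dH 4%N _ isT Ix.
have ? := dP 1%N _ isT Ix; have ? := dS 1%N _ isT Ix.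
have ? := dP 2%N _ isT Ix; have ? := dS 2%N _ isT Ix.
have ? := dP 3%N _ isT Ix; have ? := dS 3%N _ isT Ix.
by derive_by ltac:(ring).
Qed.

End linear_equation.

Section diagonal_coefficients.
Variable R : realType.
Implicit Types (p s d : R).

(* If [h'' = p h' + s h] then [h^(k) = a_k h + b_k h'], where [a_k] and [b_k]
   are polynomials in the derivatives of [p] and [s]. *)
Definition coef_a4 p0 p1 s0 s1 s2 :=
  let a3 := p0 * s0 + s1 in p0 * a3 + 2 * p1 * s0 + s0 * s0 + s2.
Definition coef_b3 p0 p1 s0 := p0 * p0 + p1 + s0.
Definition coef_b4 p0 p1 p2 s0 s1 :=
  p0 * coef_b3 p0 p1 s0 + 2 * p1 * p0 + p2 + s0 * p0 + 2 * s1.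
Definition coef_b5 p0 p1 p2 p3 s0 s1 s2 :=
  p0 * coef_b4 p0 p1 p2 s0 s1 + 3 * p1 * coef_b3 p0 p1 s0 + 3 * p2 * p0 + p3
  + s0 * coef_b3 p0 p1 s0 + 3 * s1 * p0 + 3 * s2.
Definition coef_b6 p0 p1 p2 p3 p4 s0 s1 s2 s3 :=
  p0 * coef_b5 p0 p1 p2 p3 s0 s1 s2 + 4 * p1 * coef_b4 p0 p1 p2 s0 s1
  + 6 * p2 * coef_b3 p0 p1 s0 + 4 * p3 * p0 + p4
  + s0 * coef_b4 p0 p1 p2 s0 s1 + 4 * s1 * coef_b3 p0 p1 s0 + 6 * s2 * p0 + 4 * s3.

(* The coefficients of [u ^+ 2], [u ^+ 4] and [u ^+ 6] of the mean, for
   [p = Phi] and [s = Psi]. *)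
Definition diag2 p0 := p0 / 24.
Definition diag4 p0 p1 p2 s0 s1 :=
  coef_b4 p0 p1 p2 s0 s1 / (80 * 24) - diag2 p0 / 24 * s0 - diag2 p0 ^+ 2 / 2 * p0.
Definition diag6 p0 p1 p2 p3 p4 s0 s1 s2 s3 :=
  coef_b6 p0 p1 p2 p3 p4 s0 s1 s2 s3 / (448 * 720)
  - diag2 p0 / (80 * 24) * coef_a4 p0 p1 s0 s1 s2
  - diag4 p0 p1 p2 s0 s1 / 24 * s0 - diag2 p0 * diag4 p0 p1 p2 s0 s1 * p0
  - diag2 p0 ^+ 3 / 6 * coef_b3 p0 p1 s0.

(** In [diag4] the coefficient of s1 is 2 / (80 * 24) = 1 / 960, and that of s0 is p0 / 960 - p0 /
    576 = - p0 / 1440; this is the origin of 960 and of 2 / 3. *)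
Lemma diag4_diff p0 p1 p2 s0 s1 (t0 t1 : R) :
  diag4 p0 p1 p2 s0 s1 = diag4 p0 p1 p2 t0 t1 -> s1 - t1 = 2 / 3 * p0 * (s0 - t0).
Proof.
move=> E; apply/eqP; rewrite -subr_eq0; apply/eqP.
transitivity (960 * (diag4 p0 p1 p2 s0 s1 - diag4 p0 p1 p2 t0 t1)).
  by rewrite /diag4 /coef_b4 /coef_b3 /diag2; field.
by rewrite E subrr mulr0.
Qed.

(* [d0] is the difference of the two functions [Psi]; its derivatives are those
   forced by [d' = 2 / 3 * Phi * d]. *)
Lemma diag6_diff p0 p1 p2 p3 p4 s0 s1 s2 s3 d0 : let d1 := 2 / 3 * p0 * d0 in
  let d2 := 2 / 3 * (p1 * d0 + p0 * d1) in
  let d3 := 2 / 3 * (p2 * d0 + 2 * p1 * d1 + p0 * d2) in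
  diag6 p0 p1 p2 p3 p4 s0 s1 s2 s3 =
  diag6 p0 p1 p2 p3 p4 (s0 - d0) (s1 - d1) (s2 - d2) (s3 - d3) ->
  d0 = 0 \/ s1 - p2 / 3 + 4 / 9 * p0 * p1
            - 2 / 3 * p0 * (s0 - p1 / 3 + 2 / 9 * p0 ^+ 2) = 0.
Proof.
move=> d1 d2 d3 E; set z := (X in _ \/ X = 0).
have /eqP : d0 * z = 0.
  (* If all derivatives of [Phi] in the formula are 0, then d1 = d2 = d3 = 0 and [diag6] is s3 /
     80640 - s0 * s1 / 40320, which fixes the factor - 40320. *)
  transitivity (- 8 * 7 * 720 * (diag6 p0 p1 p2 p3 p4 s0 s1 s2 s3
    - diag6 p0 p1 p2 p3 p4 (s0 - d0) (s1 - d1) (s2 - d2) (s3 - d3))).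
    rewrite /z /d3 /d2 /d1 /diag6 /diag4 /diag2 /coef_b6 /coef_b5 /coef_b4 /coef_b3 /coef_a4.
    by field.
  by rewrite E subrr mulr0.
by rewrite mulf_eq0 => /orP[] /eqP; [left|right].
Qed.

Section wronskians.
Variables (p0 p1 p2 p3 p4 s0 s1 s2 s3 s4 : R) (f g : nat -> R).
Let equation (h : nat -> R) :=
  [/\ h 2%N = p0 * h 1%N + s0 * h 0%N,
      h 3%N = p0 * h 2%N + p1 * h 1%N + s0 * h 1%N + s1 * h 0%N,
      h 4%N = p0 * h 3%N + 2 * p1 * h 2%N + p2 * h 1%N
              + s0 * h 2%N + 2 * s1 * h 1%N + s2 * h 0%N,
      h 5%N = p0 * h 4%N + 3 * p1 * h 3%N + 3 * p2 * h 2%N + p3 * h 1%N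
              + s0 * h 3%N + 3 * s1 * h 2%N + 3 * s2 * h 1%N + s3 * h 0%N &
      h 6%N = p0 * h 5%N + 4 * p1 * h 4%N + 6 * p2 * h 3%N + 4 * p3 * h 2%N
              + p4 * h 1%N + s0 * h 4%N + 4 * s1 * h 3%N + 6 * s2 * h 2%N
              + 4 * s3 * h 1%N + s4 * h 0%N].
Hypotheses (ef : equation f) (eg : equation g).
Let w i j := f i * g j - f j * g i.

(** Pairing with index 0 kills the multiples of h in h^(k) and keeps the coefficient of h'; pairing
    with index 1 keeps minus the coefficient of h. In particular s4 * h disappears from the pairing
    of order 6. *)
Lemma wronskian_coefs :
  [/\ w 2%N 0%N = p0 * w 1%N 0%N, w 2%N 1%N = - s0 * w 1%N 0%N,
      w 3%N 0%N = coef_b3 p0 p1 s0 * w 1%N 0%N &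
      [/\ w 4%N 0%N = coef_b4 p0 p1 p2 s0 s1 * w 1%N 0%N,
      w 4%N 1%N = - coef_a4 p0 p1 s0 s1 s2 * w 1%N 0%N &
      w 6%N 0%N = coef_b6 p0 p1 p2 p3 p4 s0 s1 s2 s3 * w 1%N 0%N]].
Proof.
have [F2 F3 F4 F5 F6] := ef; have [G2 G3 G4 G5 G6] := eg; rewrite /w.
have w2 : w 2%N 0%N = p0 * w 1%N 0%N by rewrite /w F2 G2; ring.
have w3 : w 3%N 0%N = coef_b3 p0 p1 s0 * w 1%N 0%N.
  transitivity (p0 * w 2%N 0%N + (p1 + s0) * w 1%N 0%N); first by rewrite /w F3 G3; ring.
  by rewrite w2 /coef_b3; ring.
have w4 : w 4%N 0%N = coef_b4 p0 p1 p2 s0 s1 * w 1%N 0%N.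
  transitivity (p0 * w 3%N 0%N + (2 * p1 + s0) * w 2%N 0%N + (p2 + 2 * s1) * w 1%N 0%N).
    by rewrite /w F4 G4; ring.
  by rewrite w2 w3 /coef_b4; ring.
have w5 : w 5%N 0%N = coef_b5 p0 p1 p2 p3 s0 s1 s2 * w 1%N 0%N.
  transitivity (p0 * w 4%N 0%N + (3 * p1 + s0) * w 3%N 0%N + (3 * p2 + 3 * s1) * w 2%N 0%N
                + (p3 + 3 * s2) * w 1%N 0%N).
    by rewrite /w F5 G5; ring.
  by rewrite w2 w3 w4 /coef_b5; ring.
have w6 : w 6%N 0%N = coef_b6 p0 p1 p2 p3 p4 s0 s1 s2 s3 * w 1%N 0%N.
  transitivity (p0 * w 5%N 0%N + (4 * p1 + s0) * w 4%N 0%N + (6 * p2 + 4 * s1) * w 3%N 0%N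
                + (4 * p3 + 6 * s2) * w 2%N 0%N + (p4 + 4 * s3) * w 1%N 0%N).
    by rewrite /w F6 G6; ring.
  by rewrite w2 w3 w4 w5 /coef_b6; ring.
have w21 : w 2%N 1%N = - s0 * w 1%N 0%N by rewrite /w F2 G2; ring.
have w31 : w 3%N 1%N = - (p0 * s0 + s1) * w 1%N 0%N.
  transitivity (p0 * w 2%N 1%N - s1 * w 1%N 0%N); first by rewrite /w F3 G3; ring.
  by rewrite w21; ring.
have w41 : w 4%N 1%N = - coef_a4 p0 p1 s0 s1 s2 * w 1%N 0%N.
  transitivity (p0 * w 3%N 1%N + (2 * p1 + s0) * w 2%N 1%N - s2 * w 1%N 0%N).
    by rewrite /w F4 G4; ring.
  by rewrite w31 w21 /coef_a4; ring.
by [].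
Qed.

Lemma diag_coefs d2 d4 d6 : w 1%N 0%N != 0 ->
  d2 * w 1%N 0%N = w 2%N 0%N / 24 ->
  d4 * w 1%N 0%N = w 4%N 0%N / (80 * 24) + d2 / 24 * w 2%N 1%N - d2 ^+ 2 / 2 * w 2%N 0%N ->
  d6 * w 1%N 0%N = w 6%N 0%N / (448 * 720) + d2 / (80 * 24) * w 4%N 1%N
    + d4 / 24 * w 2%N 1%N - d2 * d4 * w 2%N 0%N - d2 ^+ 3 / 6 * w 3%N 0%N ->
  [/\ d2 = diag2 p0, d4 = diag4 p0 p1 p2 s0 s1 &
      d6 = diag6 p0 p1 p2 p3 p4 s0 s1 s2 s3].
Proof.
move=> w0; have [-> -> -> [-> -> ->]] := wronskian_coefs.
set v := w 1%N 0%N in w0 *.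
have cancel a b : a * v = b * v -> a = b by move/(mulIf w0).
move=> E2 E4 E6.
have D2 : d2 = diag2 p0 by apply: cancel; rewrite E2 /diag2; ring.
have D4 : d4 = diag4 p0 p1 p2 s0 s1 by apply: cancel; rewrite E4 D2 /diag4; ring.
by split=> //; apply: cancel; rewrite E6 D4 D2 /diag6; ring.
Qed.

End wronskians.

End diagonal_coefficients.

(** * Pairs as solutions of a second-order linear equation *)

Section pair_theory.
Variables (R : realType) (I : set R).
Hypotheses (I_itv : is_interval I) (I_open : open I).
Implicit Types (f g F G u v q h : R -> R) (x y : R).

(** The derivative of u/v is zero. This yields the ratio of the two Wronskians, the constants of
    (iv), and the coefficients of linear combinations of f and g. *)
Lemma linear_proportional u v q :
  (forall x, I x -> is_derive x 1 u (q x * u x)) ->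
  (forall x, I x -> is_derive x 1 v (q x * v x)) ->
  (forall x, I x -> v x != 0) -> exists c, forall x, I x -> u x = c * v x.
Proof.
move=> du dv v0; have [[y Iy]|I0] := pselect (I !=set0); last first.
  by exists 0 => x Ix; case: I0; exists x.
exists (u y / v y) => x Ix.
have d0 z : I z -> is_derive z 1 (fun z => u z / v z) 0.
  move=> Iz; have duz := du _ Iz; have := is_deriveVE (v0 _ Iz) (dv _ Iz).
  move=> dvz; apply: is_derive_rew (is_deriveME duz dvz) _.
  by field; exact: v0.
by rewrite -(is_derive0_constant I_itv d0 Ix Iy) divfK// v0.
Qed.

Lemma is_derive_W f g x : Cn 2 I f -> Cn 2 I g -> I x ->
  is_derive x 1 (W 1 0 f g) (W 2 0 f g x).
Proof.
move=> cf cg Ix.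
have df := Cn_is_derive1n (n := 2) (k := 0) isT cf Ix; have dg := Cn_is_derive1n (n := 2) (k := 0) isT cg Ix.
have df' := Cn_is_derive1n (n := 2) (k := 1) isT cf Ix; have dg' := Cn_is_derive1n (n := 2) (k := 1) isT cg Ix.
have /is_derive_rew := is_deriveDE (is_deriveME df' dg) (is_deriveNE (is_deriveME df dg')).
apply; rewrite /W !derive1n0 /derive1n /=.
by move: (derive1 f) (derive1 g) => f' g'; ring.
Qed.

Section one_pair.
Variables f g : R -> R.
Hypothesis fgC6 : Cn_pair 6 I f g.

Let cf : Cn 6 I f. Proof. by case: fgC6. Qed.
Let cg : Cn 6 I g. Proof. by case: fgC6. Qed.
Let w x := cbrt (W 1 0 f g x) ^+ 2.

Lemma Cn_W_pair n i j : (n + i <= 6)%N -> (n + j <= 6)%N -> Cn n I (W i j f g).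
Proof. by move=> ni nj; exact: (Cn_W I_open ni nj). Qed.

Lemma Cn_Phi : Cn 4 I (Phi f g).
Proof.
apply: (CnM I_open); first exact: Cn_W_pair.
by apply: (CnV I_open); [move=> x; exact: (W10_neq0 fgC6)|exact: Cn_W_pair].
Qed.

Lemma Cn_Psi : Cn 4 I (Psi f g).
Proof.
apply: (CnN I_open); apply: (CnM I_open); first exact: Cn_W_pair.
by apply: (CnV I_open); [move=> x; exact: (W10_neq0 fgC6)|exact: Cn_W_pair].
Qed.

Lemma is_derive_W10 x : I x -> is_derive x 1 (W 1 0 f g) (Phi f g x * W 1 0 f g x).
Proof.
move=> Ix; apply: is_derive_rew (is_derive_W (Cn_leq _ cf) (Cn_leq _ cg) Ix) _ => //.
by rewrite /Phi divfK// (W10_neq0 fgC6).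
Qed.

Lemma cbrtW_neq0 x : I x -> cbrt (W 1 0 f g x) != 0.
Proof. by move=> Ix; rewrite cbrt_eq0 (W10_neq0 fgC6). Qed.

Lemma cbrtW_sqr_neq0 x : I x -> cbrt (W 1 0 f g x) ^+ 2 != 0.
Proof. by move=> Ix; rewrite expf_neq0// cbrtW_neq0. Qed.

Lemma is_derive_cbrtW x : I x ->
  is_derive x 1 (fun x => cbrt (W 1 0 f g x)) (Phi f g x / 3 * cbrt (W 1 0 f g x)).
Proof.
move=> Ix; have W0 := W10_neq0 fgC6 Ix; have c0 := cbrtW_neq0 Ix.
have := is_derive_compE (is_derive_cbrt W0) (is_derive_W10 Ix).
move=> /is_derive_rew; apply; rewrite -{2}(cbrtK (W 1 0 f g x)).
by field; rewrite c0.
Qed.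

Lemma is_derive_cbrtW_sqr x : I x ->
  is_derive x 1 (fun x => cbrt (W 1 0 f g x) ^+ 2)
    (2 / 3 * Phi f g x * cbrt (W 1 0 f g x) ^+ 2).
Proof.
by move=> Ix; have ? := is_derive_cbrtW Ix; derive_by ltac:(rewrite /=; field).
Qed.

(** Cramer's rule: [Phi] and [Psi] are the solution of the linear system that the two instances h =
    f and h = g form. *)
Lemma second_order h x : h = f \/ h = g -> I x ->
  derive1n 2 h x = Phi f g x * derive1n 1 h x + Psi f g x * h x.
Proof.
move=> hfg Ix; have := W10_neq0 fgC6 Ix; rewrite /Phi /Psi /W !derive1n0.
case: hfg => ->; move: (derive1n 2 f x) (derive1n 2 g x) (derive1n 1 f x) (derive1n 1 g x).
all: by move: (f x) (g x) => f0 g0 f2 g2 f1 g1 w0; field.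
Qed.

Lemma gmean_diag_formula x : I x ->
  let m := gmean_diag I f g (@lebesgue01 R) x in
  let p k := derive1n k (Phi f g) x in let s k := derive1n k (Psi f g) x in
  [/\ derive1n 2 m 0 / 2`!%:R = diag2 (p 0%N),
      derive1n 4 m 0 / 4`!%:R = diag4 (p 0%N) (p 1%N) (p 2%N) (s 0%N) (s 1%N) &
      derive1n 6 m 0 / 6`!%:R = diag6 (p 0%N) (p 1%N) (p 2%N) (p 3%N) (p 4%N)
        (s 0%N) (s 1%N) (s 2%N) (s 3%N)].
Proof.
move=> Ix m p s; have [e e0 xI] := open_ball I_open Ix.
have [E2 E4 E6] := gmean_diag_derivatives I_itv I_open fgC6 Ix e0 xI.
have dP k z : (k < 4)%N -> I z ->
    is_derive z 1 (derive1n k (Phi f g)) (derive1n k.+1 (Phi f g) z).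
  by move=> k4; exact: Cn_is_derive1n Cn_Phi.
have dS k z : (k < 4)%N -> I z ->
    is_derive z 1 (derive1n k (Psi f g)) (derive1n k.+1 (Psi f g) z).
  by move=> k4; exact: Cn_is_derive1n Cn_Psi.
have dH h k z : Cn 6 I h -> (k < 6)%N -> I z ->
    is_derive z 1 (derive1n k h) (derive1n k.+1 h z).
  by move=> ch k6; exact: Cn_is_derive1n ch.
have f2 z := second_order (x := z) (or_introl (erefl f)).
have g2 z := second_order (x := z) (or_intror (erefl g)).
have [f3 f4 f5 f6] := linear_equation_derivatives I_open
  (H := fun k => derive1n k f) (fun k z => dH f k z cf) dP dS f2 Ix.
have [g3 g4 g5 g6] := linear_equation_derivatives I_open
  (H := fun k => derive1n k g) (fun k z => dH g k z cg) dP dS g2 Ix.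
exact: (diag_coefs (f := fun k => derive1n k f x) (g := fun k => derive1n k g x)
  (And5 (f2 x Ix) f3 f4 f5 f6) (And5 (g2 x Ix) g3 g4 g5 g6) (W10_neq0 fgC6 Ix) E2 E4 E6).
Qed.

End one_pair.

End pair_theory.

Section pair_equivalence.
Variables (R : realType) (I : set R).
Hypotheses (I_itv : is_interval I) (I_open : open I) (I_neq0 : I !=set0).
Implicit Types (f g F G h : R -> R) (x y : R).

Lemma W_linear f g F G (a b c d : R) x : Cn 1 I f -> Cn 1 I g -> I x ->
  (forall x, I x -> F x = a * f x + b * g x) ->
  (forall x, I x -> G x = c * f x + d * g x) ->
  W 1 0 F G x = (a * d - b * c) * W 1 0 f g x.
Proof.
move=> cf cg Ix EF EG.
have df := Cn_is_derive (ltn0Sn 0) cf Ix; have dg := Cn_is_derive (ltn0Sn 0) cg Ix.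
have dl H (k l : R) : (forall x, I x -> H x = k * f x + l * g x) ->
    derive1n 1 H x = k * derive1n 1 f x + l * derive1n 1 g x.
  move=> EH; apply: is_derive_val; notypeclasses refine (is_derive_near (f := fun x => k * f x + l * g x) _ _).
    by apply: filterS (near_open I_open Ix) => y Iy; rewrite EH.
  by derive_by ltac:(rewrite /derive1n/=; ring).
rewrite /W (dl _ _ _ EF) (dl _ _ _ EG) !derive1n0 (EF _ Ix) (EG _ Ix).
by move: (derive1n 1 f x) (derive1n 1 g x) => f' g'; ring.
Qed.

(** If H solves the equation, its Wronskians with f and g satisfy W' = Phi W, so both are constant
    multiples of W_{f,g}, and H W_{f,g} = W_{H,g} f - W_{H,f} g exhibits H as a combination of f and
    g. The determinant is nonzero because it is the ratio of W_{F,G} to W_{f,g}. *)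
Lemma pair_equiv_of_equation f g F G : Cn_pair 6 I f g -> Cn_pair 6 I F G ->
  (forall x, I x -> Phi f g x = Phi F G x) ->
  (forall x, I x -> Psi f g x = Psi F G x) -> pair_equiv I f g F G.
Proof.
move=> fgC FGC EPhi EPsi.
have [cf cg _ _] := fgC; have [cF cG _ _] := FGC.
have C2 h : Cn 6 I h -> Cn 2 I h by exact: Cn_leq.
have combination H : Cn 6 I H ->
    (forall x, I x -> derive1n 2 H x = Phi f g x * derive1n 1 H x + Psi f g x * H x) ->
    exists a b, forall x, I x -> H x = a * f x + b * g x.
  move=> cH H2.
  have dHh h : h = f \/ h = g -> Cn 6 I h -> forall x, I x ->
      is_derive x 1 (W 1 0 H h) (Phi f g x * W 1 0 H h x).
    move=> hfg ch x Ix.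
    apply: is_derive_rew (is_derive_W (C2 _ cH) (C2 _ ch) Ix) _.
    rewrite /W (H2 _ Ix) (second_order fgC hfg Ix) !derive1n0.
    by move: (derive1n 1 H x) (derive1n 1 h x) => H' h'; ring.
  have dW x := is_derive_W10 fgC (x := x).
  have W0 x := W10_neq0 fgC (x := x).
  have [a Ea] := linear_proportional I_itv (dHh g (or_intror erefl) cg) dW W0.
  have [b Eb] := linear_proportional I_itv (dHh f (or_introl erefl) cf) dW W0.
  exists a, (- b) => x Ix; apply: (mulIf (W0 x Ix)).
  transitivity (W 1 0 H g x * f x - W 1 0 H f x * g x).
    rewrite /W !derive1n0.
    by move: (derive1n 1 H x) (derive1n 1 f x) (derive1n 1 g x) => H' f' g'; ring.
  by rewrite (Ea _ Ix) (Eb _ Ix); ring.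
have [|a [b Eab]] := combination F cF.
  by move=> x Ix; rewrite (second_order FGC (or_introl erefl) Ix) EPhi// EPsi.
have [|c [d Ecd]] := combination G cG.
  by move=> x Ix; rewrite (second_order FGC (or_intror erefl) Ix) EPhi// EPsi.
exists a, b, c, d; split; last by move=> x Ix; split; [exact: Eab|exact: Ecd].
have [x Ix] := I_neq0.
have C1 h : Cn 6 I h -> Cn 1 I h by exact: Cn_leq.
have := W10_neq0 FGC Ix; rewrite (W_linear (C1 _ cf) (C1 _ cg) Ix Eab Ecd).
by rewrite mulf_eq0 negb_or subr_eq0 => /andP[].
Qed.

Lemma pair_equivC f g F G : pair_equiv I f g F G -> pair_equiv I F G f g.
Proof.
move=> [a [b [c [d [abcd E]]]]]; set D := a * d - b * c.
have D0 : D != 0 by rewrite subr_eq0.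
exists (d / D), (- b / D), (- c / D), (a / D); split.
  have -> : d / D * (a / D) = (b * c + D) / D ^+ 2 by rewrite /D; field.
  have -> : - b / D * (- c / D) = b * c / D ^+ 2 by field.
  by rewrite -subr_eq0 -mulrBl addrAC subrr add0r mulf_neq0// invr_neq0// expf_neq0.
move=> x /E[-> ->]; rewrite {2 4}/D.
by split; rewrite /D; field.
Qed.

End pair_equivalence.

(** * From a dense part of the diagonal to all of it *)

Section diagonal_continuity.
Variables (R : realType) (I : set R).
Hypothesis I_open : open I.

Lemma CnX n k (h : R -> R) : Cn n I h -> Cn n I (fun x => h x ^+ k).
Proof.
move=> ch; elim: k => [|k ih]; first exact: Cn_cst.
by apply: (Cn_ext I_open _ (CnM I_open ch ih)) => x _; rewrite exprS.
Qed.

Ltac Cn_closure := repeat match goal with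
  | |- Cn 0 I (fun _ => ?c) => refine (Cn_cst _ _ _)
  | |- Cn 0 I (fun x => @?a x + @?b x) => refine (@CnD _ _ I_open _ a b _ _)
  | |- Cn 0 I (fun x => - @?a x) => refine (@CnN _ _ I_open _ a _)
  | |- Cn 0 I (fun x => @?a x * @?b x) => refine (@CnM _ _ I_open _ a b _ _)
  | |- Cn 0 I (fun x => @?a x ^+ ?k) => refine (@CnX _ k a _)
  | _ => eassumption
  end.

Variables p0 p1 p2 p3 p4 s0 s1 s2 s3 : R -> R.
Hypotheses (c0 : Cn 0 I p0) (c1 : Cn 0 I p1) (c2 : Cn 0 I p2) (c3 : Cn 0 I p3)
  (c4 : Cn 0 I p4).
Hypotheses (e0 : Cn 0 I s0) (e1 : Cn 0 I s1) (e2 : Cn 0 I s2) (e3 : Cn 0 I s3).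

Lemma diag2_continuous : Cn 0 I (fun x => diag2 (p0 x)).
Proof. by rewrite /diag2; Cn_closure. Qed.

Let b3_continuous : Cn 0 I (fun x => coef_b3 (p0 x) (p1 x) (s0 x)).
Proof. by rewrite /coef_b3; Cn_closure. Qed.

Let b4_continuous : Cn 0 I (fun x => coef_b4 (p0 x) (p1 x) (p2 x) (s0 x) (s1 x)).
Proof. by have ? := b3_continuous; rewrite /coef_b4; Cn_closure. Qed.

Let b5_continuous :
  Cn 0 I (fun x => coef_b5 (p0 x) (p1 x) (p2 x) (p3 x) (s0 x) (s1 x) (s2 x)).
Proof. by have ? := b3_continuous; have ? := b4_continuous; rewrite /coef_b5; Cn_closure. Qed.

Let b6_continuous : Cn 0 I (fun x =>
  coef_b6 (p0 x) (p1 x) (p2 x) (p3 x) (p4 x) (s0 x) (s1 x) (s2 x) (s3 x)).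
Proof.
have ? := b3_continuous; have ? := b4_continuous; have ? := b5_continuous.
by rewrite /coef_b6; Cn_closure.
Qed.

Let a4_continuous : Cn 0 I (fun x => coef_a4 (p0 x) (p1 x) (s0 x) (s1 x) (s2 x)).
Proof. by rewrite /coef_a4; Cn_closure. Qed.

Lemma diag4_continuous : Cn 0 I (fun x => diag4 (p0 x) (p1 x) (p2 x) (s0 x) (s1 x)).
Proof.
by have ? := b4_continuous; have ? := diag2_continuous; rewrite /diag4; Cn_closure.
Qed.

Lemma diag6_continuous : Cn 0 I (fun x =>
  diag6 (p0 x) (p1 x) (p2 x) (p3 x) (p4 x) (s0 x) (s1 x) (s2 x) (s3 x)).
Proof.
have ? := b3_continuous; have ? := b6_continuous; have ? := a4_continuous.
by have ? := diag2_continuous; have ? := diag4_continuous; rewrite /diag6; Cn_closure.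
Qed.

End diagonal_continuity.

Section near_diagonal.
Variables (R : realType) (I : set R).
Hypotheses (I_itv : is_interval I) (I_open : open I).

(** If h x were nonzero, the points with [h p.1 != 0] would form a neighbourhood of (x, x), which
    has to meet D. *)
Lemma dense_diagonal_eq0 (D : set (R * R)) (h : R -> R) :
  D `<=` [set (x, x) | x in I] -> [set (x, x) | x in I] `<=` closure D ->
  (forall x, I x -> {for x, continuous h}) -> (forall x, D (x, x) -> h x = 0) ->
  forall x, I x -> h x = 0.
Proof.
move=> DI ID ch h0 x Ix; apply/eqP; apply/negPn/negP => hx0.
have /ID cl : [set (x, x) | x in I] (x, x) by exists x.
have V : \forall p \near (x, x), h p.1 != 0.
  have hn : \forall y \near x, h y != 0 by exact: (cvgr_neq0 _ (ch _ Ix) hx0).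
  exact: (cvg_fst (F := nbhs x) (G := nbhs x) hn).
have [p [Dp]] := cl _ V.
have [y Iy yp] := DI _ Dp; rewrite -yp /= in Dp *.
by rewrite (h0 _ Dp) eqxx.
Qed.

Lemma near_diagonal (U : set (R * R)) x : open U -> U (x, x) ->
  \forall u \near (0 : R), U (x + u / 2, x - u / 2).
Proof.
move=> Uo Ux.
have c1 : {for (0 : R), continuous (fun u : R => x + u / 2)}.
  by apply: is_derive_continuous; derive_by reflexivity.
have c2 : {for (0 : R), continuous (fun u : R => x - u / 2)}.
  by apply: is_derive_continuous; derive_by reflexivity.
have UU : nbhs (x, x) U by apply: open_nbhs_nbhs.
by apply: (cvg_pair c1 c2); rewrite mul0r subr0 addr0.
Qed.

Variables f g F G : R -> R.
Hypotheses (fgC : Cn_pair 6 I f g) (FGC : Cn_pair 6 I F G).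
Notation Mfg := (gmean I f g (@lebesgue01 R)).
Notation MFG := (gmean I F G (@lebesgue01 R)).
Notation mfg := (gmean_diag I f g (@lebesgue01 R)).
Notation mFG := (gmean_diag I F G (@lebesgue01 R)).

(** The left-hand side is a derivative in the displacement for fixed x; its continuity in x is read
    off from the formula in [Phi] and [Psi]. *)
Let continuous_coef (u v : R -> R) : Cn_pair 6 I u v ->
  exists2 m : nat -> R -> R, forall k, k \in [:: 2; 4; 6]%N -> Cn 0 I (m k) &
  forall k x, k \in [:: 2; 4; 6]%N -> I x ->
    derive1n k (gmean_diag I u v (@lebesgue01 R) x) 0 / k`!%:R = m k x.
Proof.
move=> uvC.
have cP k : (k <= 4)%N -> Cn 0 I (derive1n k (Phi u v)).
  move=> k4; apply: Cn_derive1n; rewrite addn0.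
  exact: (Cn_leq k4 (Cn_Phi I_open uvC)).
have cS k : (k <= 4)%N -> Cn 0 I (derive1n k (Psi u v)).
  move=> k4; apply: Cn_derive1n; rewrite addn0.
  exact: (Cn_leq k4 (Cn_Psi I_open uvC)).
pose p k := derive1n k (Phi u v); pose s k := derive1n k (Psi u v).
exists (fun k x => if k == 2%N then diag2 (p 0%N x) else if k == 4%N then
   diag4 (p 0%N x) (p 1%N x) (p 2%N x) (s 0%N x) (s 1%N x) else
   diag6 (p 0%N x) (p 1%N x) (p 2%N x) (p 3%N x) (p 4%N x)
     (s 0%N x) (s 1%N x) (s 2%N x) (s 3%N x)).
  move=> k; rewrite !inE => /or3P[] /eqP -> /=.
  - exact: (diag2_continuous I_open (cP 0%N isT)).
  - exact: (diag4_continuous I_open (cP 0%N isT) (cP 1%N isT) (cP 2%N isT)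
      (cS 0%N isT) (cS 1%N isT)).
  - exact: (diag6_continuous I_open (cP 0%N isT) (cP 1%N isT) (cP 2%N isT)
      (cP 3%N isT) (cP 4%N isT) (cS 0%N isT) (cS 1%N isT) (cS 2%N isT) (cS 3%N isT)).
move=> k x; rewrite !inE => /or3P[] /eqP -> Ix /=.
all: by have [] := gmean_diag_formula I_itv I_open uvC Ix.
Qed.

(** At a point of D the two means agree for all small displacements, hence so do their derivatives
    at 0. Density and continuity in x extend this to I. *)
Lemma near_diagonal_derivatives : eq_near_diagonal I Mfg MFG ->
  forall x k, I x -> k \in [:: 2; 4; 6]%N ->
  derive1n k (mfg x) 0 = derive1n k (mFG x) 0.
Proof.
move=> [U [D [[Uo UI DD DclD DU] EU]]] x k Ix k246.
have [m cm Em] := continuous_coef fgC.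
have [n cn En] := continuous_coef FGC.
have k0 : k`!%:R != 0 :> R by rewrite pnatr_eq0 -lt0n fact_gt0.
apply: (@mulIf _ (k`!%:R)^-1); first by rewrite invr_neq0.
rewrite (Em _ _ k246 Ix) (En _ _ k246 Ix); apply/eqP; rewrite -subr_eq0; apply/eqP.
apply: (dense_diagonal_eq0 (h := fun x => m k x - n k x) DD DclD) => //.
  move=> y Iy; apply: continuousB.
    exact: (Cn_continuous (cm _ k246)).
  exact: (Cn_continuous (cn _ k246)).
move=> y Dy; have Uy := DU _ Dy; have [Iy _] := UI _ Uy.
rewrite -(Em _ _ k246 Iy) -(En _ _ k246 Iy); apply/eqP; rewrite subr_eq0; apply/eqP.
congr (_ / _); apply: eq_derive1n.
apply: filterS (near_diagonal Uo Uy) => u Uu.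
by rewrite !gmean_diagE; exact: EU Uu.
Qed.

End near_diagonal.

Section derivatives_to_equation.
Variables (R : realType) (I : set R).
Hypotheses (I_itv : is_interval I) (I_open : open I) (I_neq0 : I !=set0).
Variables f g F G : R -> R.
Hypotheses (fgC : Cn_pair 6 I f g) (FGC : Cn_pair 6 I F G).
Notation mfg := (gmean_diag I f g (@lebesgue01 R)).
Notation mFG := (gmean_diag I F G (@lebesgue01 R)).

Lemma equation_of_derivatives :
  (forall x, I x ->
      [/\ derive1n 2 (mfg x) 0 = derive1n 2 (mFG x) 0,
          derive1n 4 (mfg x) 0 = derive1n 4 (mFG x) 0 &
          derive1n 6 (mfg x) 0 = derive1n 6 (mFG x) 0]) ->
  pair_equiv I f g F G \/
    (forall x, I x -> Phi f g x = Phi F G x) /\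
    exists alpha beta : R, forall x, I x ->
      Psi f g x = alpha * cbrt (W 1 0 f g x) ^+ 2
                  + 3^-1 * derive1 (Phi f g) x - 2 / 9 * Phi f g x ^+ 2 /\
      Psi F G x = beta * cbrt (W 1 0 f g x) ^+ 2
                  + 3^-1 * derive1 (Phi f g) x - 2 / 9 * Phi f g x ^+ 2.
Proof.
move=> Em; have EPhi x : I x -> Phi f g x = Phi F G x.
  move=> Ix; have [E2 _ _] := Em _ Ix.
  have [Efg _ _] := gmean_diag_formula I_itv I_open fgC Ix.
  have [EFG _ _] := gmean_diag_formula I_itv I_open FGC Ix.
  have : (24 : R)^-1 != 0 by rewrite invr_neq0// pnatr_eq0.
  by move=> /mulIf; apply; rewrite -[LHS]Efg -[RHS]EFG E2.
pose p k := derive1n k (Phi f g); pose s k := derive1n k (Psi f g).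
pose t k := derive1n k (Psi F G).
have Ep k x : I x -> derive1n k (Phi F G) x = p k x.
  move=> Ix; apply: eq_derive1n; apply: filterS (near_open I_open Ix) => y Iy.
  by rewrite EPhi.
have dp k x : (k < 4)%N -> I x -> is_derive x 1 (p k) (p k.+1 x).
  by move=> k4; exact: (Cn_is_derive1n k4 (Cn_Phi I_open fgC)).
have ds k x : (k < 4)%N -> I x -> is_derive x 1 (s k) (s k.+1 x).
  by move=> k4; exact: (Cn_is_derive1n k4 (Cn_Psi I_open fgC)).
have dt k x : (k < 4)%N -> I x -> is_derive x 1 (t k) (t k.+1 x).
  by move=> k4; exact: (Cn_is_derive1n k4 (Cn_Psi I_open FGC)).
pose d k x := s k x - t k x.
have dd k x : (k < 4)%N -> I x -> is_derive x 1 (d k) (d k.+1 x).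
  by move=> k4 Ix; exact: is_deriveDE (ds k x k4 Ix) (is_deriveNE (dt k x k4 Ix)).
have formulas x : I x ->
  diag4 (p 0%N x) (p 1%N x) (p 2%N x) (s 0%N x) (s 1%N x) =
  diag4 (p 0%N x) (p 1%N x) (p 2%N x) (t 0%N x) (t 1%N x) /\
  diag6 (p 0%N x) (p 1%N x) (p 2%N x) (p 3%N x) (p 4%N x)
        (s 0%N x) (s 1%N x) (s 2%N x) (s 3%N x) =
  diag6 (p 0%N x) (p 1%N x) (p 2%N x) (p 3%N x) (p 4%N x)
        (t 0%N x) (t 1%N x) (t 2%N x) (t 3%N x).
  move=> Ix; have [_ E4 E6] := Em _ Ix.
  have [_ Efg4 Efg6] := gmean_diag_formula I_itv I_open fgC Ix.
  have [_ EFG4 EFG6] := gmean_diag_formula I_itv I_open FGC Ix.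
  have ext4 a b c a' b' c' u v : a = a' -> b = b' -> c = c' ->
      diag4 a b c u v = diag4 a' b' c' u v :> R by move=> -> -> ->.
  have ext6 a b c u v a' b' c' u' v' s0 s1 s2 s3 :
      a = a' -> b = b' -> c = c' -> u = u' -> v = v' ->
      diag6 a b c u v s0 s1 s2 s3 = diag6 a' b' c' u' v' s0 s1 s2 s3 :> R.
    by move=> -> -> -> -> ->.
  have e k := Ep k x Ix.
  split.
    apply: etrans (esym Efg4) _; apply: etrans (congr1 (fun v => v / _) E4) _.
    exact: (etrans EFG4 (ext4 _ _ _ _ _ _ _ _ (e 0%N) (e 1%N) (e 2%N))).
  apply: etrans (esym Efg6) _; apply: etrans (congr1 (fun v => v / _) E6) _.
  exact: (etrans EFG6 (ext6 _ _ _ _ _ _ _ _ _ _ _ _ _ _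
    (e 0%N) (e 1%N) (e 2%N) (e 3%N) (e 4%N))).
(* This relation holds on all of I, so it can be differentiated twice more; [diag6_diff] expects the
   derivatives of d in the resulting form. *)
have d1 x : I x -> d 1%N x = 2 / 3 * p 0%N x * d 0%N x.
  by move=> /formulas[/diag4_diff E4 _].
have d2 x : I x -> d 2%N x = 2 / 3 * (p 1%N x * d 0%N x + p 0%N x * d 1%N x).
  move=> Ix; apply: (is_derive_unique I_open Ix d1 (dd 1%N x isT Ix)).
  have ? := dp 0%N x isT Ix; have ? := dd 0%N x isT Ix.
  by clearbody p d; derive_by ltac:(ring).
have d3 x : I x -> d 3%N x =
    2 / 3 * (p 2%N x * d 0%N x + 2 * p 1%N x * d 1%N x + p 0%N x * d 2%N x).
  move=> Ix; apply: (is_derive_unique I_open Ix d2 (dd 2%N x isT Ix)).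
  have ? := dp 0%N x isT Ix; have ? := dd 0%N x isT Ix.
  have ? := dp 1%N x isT Ix; have ? := dd 1%N x isT Ix.
  by clearbody p d; derive_by ltac:(ring).
have dichotomy x : I x -> d 0%N x = 0 \/ s 1%N x - p 2%N x / 3 + 4 / 9 * p 0%N x * p 1%N x
    - 2 / 3 * p 0%N x * (s 0%N x - p 1%N x / 3 + 2 / 9 * p 0%N x ^+ 2) = 0.
  move=> Ix.
  apply: (diag6_diff (p3 := p 3%N x) (p4 := p 4%N x) (s2 := s 2%N x) (s3 := s 3%N x)).
  have [_ ->] := formulas _ Ix.
  have E1 := d1 _ Ix; have E2 := d2 _ Ix; have E3 := d3 _ Ix.
  rewrite -E1 -E2 -E3.
  have tE k : t k x = s k x - d k x by rewrite /d opprB addrC subrK.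
  by rewrite (tE 0%N) (tE 1%N) (tE 2%N) (tE 3%N).
have w' x := is_derive_cbrtW_sqr fgC (x := x).
have w0 x := cbrtW_sqr_neq0 fgC (x := x).
have [c dc] : exists c, forall x, I x -> d 0%N x = c * cbrt (W 1 0 f g x) ^+ 2.
  apply: (linear_proportional I_itv _ w' w0) => x Ix.
  by have := dd 0%N x isT Ix; rewrite d1.
(* The 2/3 power of the Wronskian vanishes nowhere, so the alternative becomes global: either d = 0
   on I, or d is nonzero everywhere and [dichotomy] gives its second case at every point. *)
have [c0|c0] := eqVneq c 0.
  left; apply: pair_equiv_of_equation => // x Ix.
  by apply/eqP; rewrite -subr_eq0; apply/eqP; apply: etrans (dc _ Ix) _; rewrite c0 mul0r.
right; split => //.
have [a ra] : exists a, forall x, I x ->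
    s 0%N x - p 1%N x / 3 + 2 / 9 * p 0%N x ^+ 2 = a * cbrt (W 1 0 f g x) ^+ 2.
  apply: (linear_proportional I_itv _ w' w0) => x Ix.
  have [|z0] := dichotomy _ Ix.
    by rewrite dc// => /eqP; rewrite mulf_eq0 (negbTE c0) (negbTE (w0 _ Ix)).
  have ? := ds 0%N x isT Ix; have ? := dp 0%N x isT Ix; have ? := dp 1%N x isT Ix.
  rewrite (_ : Phi f g x = p 0%N x)//; clearbody p s.
  derive_by ltac:(idtac); apply/eqP; rewrite -subr_eq0 -[X in _ == X]z0; apply/eqP.
  by rewrite /=; field.
(* Psi_{F,G} = Psi_{f,g} - d, and d is c times the 2/3 power of the Wronskian; hence the second
   constant. *)
exists a, (a - c) => x Ix; have r := ra _ Ix; have e := dc _ Ix.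
rewrite (_ : Phi f g x = p 0%N x)// (_ : derive1 (Phi f g) x = p 1%N x)//.
rewrite (_ : Psi f g x = s 0%N x)// (_ : Psi F G x = t 0%N x)//.
have {e} : s 0%N x - t 0%N x = c * cbrt (W 1 0 f g x) ^+ 2 by [].
move: r; move: (cbrt _ ^+ 2) (p 0%N x) (p 1%N x) (s 0%N x) (t 0%N x).
by move=> w q0 q1 s0 t0 r e; split; lra.
Qed.

End derivatives_to_equation.

(** * From the differential equation to quasiarithmetic means *)

Section quadratic_relation.
Variables (R : realType) (I : set R).
Hypotheses (I_itv : is_interval I) (I_open : open I) (I_neq0 : I !=set0).
Variables f g : R -> R.
Hypothesis fgC : Cn_pair 6 I f g.
Implicit Types (x y a b c : R).
Let k x := cbrt (W 1 0 f g x).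

Let cf : Cn 6 I f. Proof. by case: fgC. Qed.
Let cg : Cn 6 I g. Proof. by case: fgC. Qed.
Let k0 x : I x -> k x != 0. Proof. exact: (cbrtW_neq0 fgC). Qed.

Let WE x : derive1 f x * g x - f x * derive1 g x = k x ^+ 3.
Proof. by rewrite /k cbrtK. Qed.

Let dk x : I x -> is_derive x 1 k (Phi f g x / 3 * k x).
Proof. exact: (is_derive_cbrtW fgC). Qed.

Lemma cbrtW_continuous x : I x -> {for x, continuous (fun x => cbrt (W 1 0 f g x))}.
Proof. by move=> /dk; exact: is_derive_continuous. Qed.

(* In the variable [phi] with [phi' = k], the functions [p = f / k] and
   [q = g / k] solve [y'' = alpha y]; the three bilinear first integrals of this
   equation, [K u v = u' v' - alpha u v], are the coefficients of the form. *)
Lemma quadratic_relation alpha :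
  (forall x, I x -> Psi f g x = alpha * cbrt (W 1 0 f g x) ^+ 2
                  + 3^-1 * derive1 (Phi f g) x - 2 / 9 * Phi f g x ^+ 2) ->
  exists a b c, forall x, I x ->
    a * f x ^+ 2 + b * f x * g x + c * g x ^+ 2 = cbrt (W 1 0 f g x) ^+ 2.
Proof.
move=> EPsi.
(* e h = k (h / k)', so e h / k^2 is the derivative of h / k with respect to phi. *)
pose e h x := derive1 h x - Phi f g x / 3 * h x.
pose p' := derive1 (Phi f g).
have dPhi x : I x -> is_derive x 1 (Phi f g) (p' x).
  exact: (Cn_is_derive _ (Cn_Phi I_open fgC)).
have dh h : h = f \/ h = g -> Cn 6 I h -> forall x, I x ->
    is_derive x 1 h (e h x + Phi f g x / 3 * h x) /\
    is_derive x 1 (e h) (2 / 3 * Phi f g x * e h x + alpha * k x ^+ 2 * h x).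
  move=> hfg ch x Ix.
  have d1 := Cn_is_derive (isT : 0 < 6)%N ch Ix.
  have d2 : is_derive x 1 (derive1 h) (derive1n 2 h x).
    exact: (Cn_is_derive1n (k := 1) (isT : 1 < 6)%N ch Ix).
  split; first by rewrite subrK.
  have dP := dPhi x Ix; rewrite (second_order fgC hfg Ix) EPsi// in d2.
  rewrite -/(k x) -/(p' x) (_ : derive1n 1 h x = derive1 h x)// in d2.
  rewrite /e; move: d1 d2 dP; move: (derive1 h) => h' d1 d2 dP.
  by derive_by ltac:(field).
pose K u v x := e u x * e v x / (k x ^+ 2 * k x ^+ 2) - alpha * (u x * v x) / k x ^+ 2.
have dK u v : u = f \/ u = g -> v = f \/ v = g -> Cn 6 I u -> Cn 6 I v ->
    forall x, I x -> is_derive x 1 (K u v) 0.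
  move=> ufg vfg cu cv x Ix.
  have [du deu] := dh u ufg cu x Ix; have [dv dev] := dh v vfg cv x Ix.
  have kx := dk Ix; have nk := k0 Ix.
  have dV : is_derive x 1 (fun x => (k x ^+ 2)^-1) (- (2 / 3 * Phi f g x) / k x ^+ 2).
    apply: is_derive_rew (is_deriveVE (f := fun x => k x ^+ 2) (expf_neq0 2 nk)
      (is_deriveXE 2 kx)) _.
    by rewrite /=; field.
  have {}dK : is_derive x 1 (fun x => e u x * e v x * ((k x ^+ 2)^-1 * (k x ^+ 2)^-1)
      - alpha * (u x * v x) * (k x ^+ 2)^-1) 0.
    move: du deu dv dev dV; clearbody e; move: (e u) (e v) => eu ev du deu dv dev dV.
    derive_by ltac:(idtac); move: (Phi f g x) (k x) nk => P l nk.
    by rewrite /=; field.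
  apply: is_derive_near dK; apply: filterS (near_open I_open Ix) => y Iy.
  by rewrite /K [(k y ^+ 2 * _)^-1]invfM.
have [y Iy] := I_neq0.
(* With these coefficients the terms in alpha cancel, and what remains is ((e f) g - f (e g))^2 /
   k^4 = W^2 / k^4 = k^2. *)
exists (K g g y), (- 2 * K f g y), (K f f y) => x Ix.
have Kc u v : u = f \/ u = g -> v = f \/ v = g -> Cn 6 I u -> Cn 6 I v -> K u v y = K u v x.
  by move=> ufg vfg cu cv; apply: (is_derive0_constant I_itv (dK u v ufg vfg cu cv)).
rewrite !Kc; [|by [left|right|]..].
rewrite -/(k x).
transitivity ((derive1 f x * g x - f x * derive1 g x) ^+ 2 / k x ^+ 4).
  by rewrite /K /e; move: (k0 Ix) => nk; field.
by rewrite WE; move: (k0 Ix) => nk; field.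
Qed.

End quadratic_relation.

Section hyperbolic.
Variable R : realType.
Implicit Types (t x : R).

Lemma S_C_derive alpha : exists2 kappa : R, 0 < kappa & forall t : R,
  [/\ is_derive t 1 (S_ alpha) (kappa * C_ alpha t),
      is_derive t 1 (C_ alpha) (alpha / kappa * S_ alpha t) &
      C_ alpha t ^+ 2 - alpha / kappa ^+ 2 * S_ alpha t ^+ 2 = 1].
Proof.
have [alpha_lt0|alpha_gt0|->] := ltgtP alpha 0.
- have s0 : 0 < Num.sqrt (- alpha) by rewrite sqrtr_gt0 oppr_gt0.
  have sE : alpha = - Num.sqrt (- alpha) ^+ 2 by rewrite sqr_sqrtr ?opprK// oppr_ge0 ltW.
  exists (Num.sqrt (- alpha)) => // t; rewrite /S_ /C_ alpha_lt0.
  move: (Num.sqrt (- alpha)) s0 sE => s s0 ->; have sn0 := lt0r_neq0 s0.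
  have ds : is_derive t 1 (fun t : R => s * t) s by derive_by ltac:(ring).
  split.
  + by apply: is_derive_rew (is_derive_compE (is_derive_sin _) ds) _; rewrite mulrC.
  + by apply: is_derive_rew (is_derive_compE (is_derive_cos _) ds) _; field.
  + by rewrite -[RHS](cos2Dsin2 (s * t)); field.
- have s0 : 0 < Num.sqrt alpha by rewrite sqrtr_gt0.
  have sE : alpha = Num.sqrt alpha ^+ 2 by rewrite sqr_sqrtr// ltW.
  exists (Num.sqrt alpha) => // t.
  rewrite /S_ /C_ ltNge (ltW alpha_gt0) /= gt_eqF//.
  move: (Num.sqrt alpha) s0 sE => s s0 ->; have sn0 := lt0r_neq0 s0.
  have ds : is_derive t 1 (fun t : R => s * t) s by derive_by ltac:(ring).
  have de := is_derive_compE (is_derive_expR _) ds.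
  have dn := is_derive_compE (is_derive_expR _) (is_deriveNE ds).
  split.
  + by derive_by ltac:(field).
  + by derive_by ltac:(field).
  + have : expR (s * t) * expR (- (s * t)) = 1 by rewrite -expRD subrr expR0.
    move: (expR (s * t)) (expR (- (s * t))) => u v uv.
    by apply: (etrans _ uv); field.
- exists 1 => // t; rewrite /S_ /C_ ltxx eqxx.
  split.
  + by rewrite mulr1; exact: is_derive_idE.
  + by rewrite !mul0r; exact: is_derive_cstE.
  + by rewrite !mul0r expr1n subr0.
Qed.

End hyperbolic.

Section polynomial_generator.
Variables (R : realType) (I : set R).
Hypotheses (I_itv : is_interval I) (I_open : open I).
Variables f g : R -> R.
Hypothesis fgC : Cn_pair 6 I f g.
Implicit Types (x y a b c : R).
Let k x := cbrt (W 1 0 f g x).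

Let g0 x : I x -> 0 < g x. Proof. exact: (pair_gt0 fgC). Qed.
Let k0 x : I x -> k x != 0. Proof. exact: (cbrtW_neq0 fgC). Qed.
Let WE x : W 1 0 f g x = k x ^+ 3. Proof. by rewrite /k cbrtK. Qed.

Lemma horner_quadratic (P : {poly R}) (t : R) : (size P <= 3)%N ->
  P.[t] = P`_2 * t ^+ 2 + P`_1 * t + P`_0.
Proof.
move=> P3; rewrite (horner_coef_wide _ P3) !big_ord_recl big_ord0 /= /bump /= !add1n.
by ring.
Qed.

Lemma horner_quotient (P : {poly R}) x : (size P <= 3)%N -> I x ->
  P.[f x / g x] =
  (P`_2 * f x ^+ 2 + P`_1 * f x * g x + P`_0 * g x ^+ 2) / g x ^+ 2.
Proof.
move=> P3 Ix; rewrite horner_quadratic//; move: (lt0r_neq0 (g0 Ix)) => gn.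
by field.
Qed.

Lemma sqrt_cube_of_sqr (u : R) : Num.sqrt ((u ^+ 2) ^+ 3) = `|u| ^+ 3.
Proof.
have -> : (u ^+ 2) ^+ 3 = (`|u| ^+ 3) ^+ 2.
  by rewrite -!exprM mulnC exprM [in RHS]exprM -normrX real_normK ?num_real.
by rewrite sqrtr_sqr normrX normr_id.
Qed.

Lemma polynomial_of_quadratic a b c :
  (forall x, I x ->
    a * f x ^+ 2 + b * f x * g x + c * g x ^+ 2 = cbrt (W 1 0 f g x) ^+ 2) ->
  exists2 P : {poly R}, (size P <= 3)%N & forall x, I x ->
    P.[f x / g x] = (cbrt (W 1 0 f g x) / g x) ^+ 2.
Proof.
move=> E; exists (Poly [:: c; b; a]); first exact: size_Poly.
move=> x Ix; rewrite expr_div_n -E//.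
rewrite /= !horner_cons horner0; move: (lt0r_neq0 (g0 Ix)) => gn.
by field.
Qed.

Let derive_quotient x : I x ->
  derive1 (fun z => f z / g z) x = k x ^+ 3 / g x ^+ 2.
Proof. by move=> Ix; rewrite -WE; apply: is_derive_val; exact: (is_derive_quotient fgC). Qed.

(** With P = (k/g)^2 along f/g and (f/g)' = k^3 / g^2, dividing |(f/g)'| by |k/g|^3 gives g. The
    absolute value comes from the square root of a sixth power. *)
Lemma generator_of_polynomial (P : {poly R}) :
  (forall x, I x -> P.[f x / g x] = (cbrt (W 1 0 f g x) / g x) ^+ 2) ->
  forall x, I x -> 0 < P.[f x / g x] /\
  g x = `|derive1 (fun z => f z / g z) x| * (Num.sqrt (P.[f x / g x] ^+ 3))^-1.
Proof.
move=> EP x Ix; rewrite EP// -/(k x).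
have kn := k0 Ix; have gp := g0 Ix.
split.
  by rewrite lt_neqAle sqr_ge0 andbT eq_sym sqrf_eq0 mulf_neq0// invr_neq0// lt0r_neq0.
rewrite derive_quotient// sqrt_cube_of_sqr !normf_div !normrX.
rewrite !(ger0_norm (ltW gp)).
have nk : `|k x| != 0 by rewrite normr_eq0.
by move: (lt0r_neq0 gp) => gn; field; rewrite nk gn.
Qed.

(** The hypothesis says that the root of P^3 is |(f/g)'| / g; squaring gives P^3 = (k/g)^6, and
    cubes are injective. *)
Lemma quadratic_of_generator (P : {poly R}) :
  (forall x, I x -> 0 < P.[f x / g x]) ->
  (forall x, I x -> g x =
    `|derive1 (fun z => f z / g z) x| * (Num.sqrt (P.[f x / g x] ^+ 3))^-1) ->
  forall x, I x -> P.[f x / g x] = (cbrt (W 1 0 f g x) / g x) ^+ 2.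
Proof.
move=> P0 EP x Ix; rewrite -/(k x).
have kn := k0 Ix; have gp := g0 Ix; have := EP _ Ix.
rewrite derive_quotient// => {}EP; set p := P.[_] in EP *.
have p0 : 0 < p by exact: P0.
have sp : 0 < Num.sqrt (p ^+ 3) by rewrite sqrtr_gt0 exprn_gt0.
apply: cube_inj; rewrite /= -[LHS]sqr_sqrtr ?exprn_ge0 ?ltW//.
have -> : Num.sqrt (p ^+ 3) = `|k x ^+ 3 / g x ^+ 2| / g x.
  have -> : `|k x ^+ 3 / g x ^+ 2| = g x * Num.sqrt (p ^+ 3).
    by move: EP; set A := `|_|; clearbody A => ->; rewrite divfK// lt0r_neq0.
  by rewrite mulrAC divff ?mul1r// lt0r_neq0.
rewrite expr_div_n real_normK ?num_real//.
by move: (lt0r_neq0 gp) => gn; field.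
Qed.

(** By the chain rule, phi read in the variable f/g has derivative k g^2 / k^3 = (g/k)^2 = 1/P. *)
Lemma antiderivative_inv_quotient (phi : R -> R) (P : {poly R}) :
  (forall x, I x -> P.[f x / g x] = (cbrt (W 1 0 f g x) / g x) ^+ 2) ->
  antiderivative I (fun x => cbrt (W 1 0 f g x)) phi ->
  antiderivative [set f x / g x | x in I] (fun y => P.[y]^-1)
    (fun y => phi (inv_on I (fun z => f z / g z) y)).
Proof.
move=> EP dphi _ [x Ix <-]; have h_inj := quotient_inj I_itv I_open fgC.
have dinv := is_derive_inv_on I_open h_inj (is_derive_quotient fgC) Ix
  (quotient_derive_neq0 fgC Ix).
have invx := inv_onK h_inj Ix; have dphix := dphi _ Ix.
rewrite -{1}invx in dphix.
apply: is_derive_rew (is_derive_compE dphix dinv) _.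
rewrite EP// -/(k x) WE.
by move: (k0 Ix) (lt0r_neq0 (g0 Ix)) => kn gn; field; rewrite kn gn.
Qed.

Lemma is_derive_comp_quotient (P : {poly R}) (intP : R -> R) x :
  (forall x, I x -> P.[f x / g x] = (cbrt (W 1 0 f g x) / g x) ^+ 2) ->
  antiderivative [set f x / g x | x in I] (fun y => P.[y]^-1) intP -> I x ->
  is_derive x 1 (fun x => intP (f x / g x)) (cbrt (W 1 0 f g x)).
Proof.
move=> EP dP Ix; have dPx := dP (f x / g x) (ex_intro2 _ _ x Ix erefl).
apply: is_derive_rew (is_derive_compE (g := fun x => f x / g x) dPx
  (is_derive_quotient fgC Ix)) _.
rewrite EP// -/(k x) WE.
by move: (k0 Ix) (lt0r_neq0 (g0 Ix)) => kn gn; field; rewrite kn gn.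
Qed.

(* Differentiating the quadratic relation shows that [p = f / k] and [q = g / k]
   solve a linear system with constant coefficients with respect to [phi]:
   [p' = (b p + 2 c q) / 2] and [q' = - (2 a p + b q) / 2] if [phi' = k]. *)
Lemma oscillation (phi j : R -> R) (a b c l : R) :
  (forall x, I x ->
    a * f x ^+ 2 + b * f x * g x + c * g x ^+ 2 = cbrt (W 1 0 f g x) ^+ 2) ->
  (forall x, I x -> is_derive x 1 phi (j x)) ->
  (forall x, I x -> cbrt (W 1 0 f g x) = l * j x) -> I !=set0 ->
  exists alpha, pair_equiv I f g (fun x => derive1 phi x * S_ alpha (phi x))
                           (fun x => derive1 phi x * C_ alpha (phi x)).
Proof.
move=> E dphi kj [x0 Ix0].
(* The factor [l] between the cube root of the Wronskian and phi' allows both pairs to share one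
   phi. *)
have l0 : l != 0 by apply: contraNneq (k0 Ix0) => l0; rewrite /k kj// l0 mul0r.
have [cf cg _ _] := fgC.
have dk x : I x -> is_derive x 1 k (Phi f g x / 3 * k x).
  exact: (is_derive_cbrtW fgC).
have df x : I x -> is_derive x 1 f (derive1 f x) by exact: (Cn_is_derive _ cf).
have dg x : I x -> is_derive x 1 g (derive1 g x) by exact: (Cn_is_derive _ cg).
have WE' x : derive1 f x * g x - f x * derive1 g x = k x ^+ 3 by exact: WE.
have relation x : I x ->
    (2 * a * f x + b * g x) * derive1 f x + (b * f x + 2 * c * g x) * derive1 g x =
    2 / 3 * Phi f g x * k x ^+ 2.
  move=> Ix; have dfx := df _ Ix; have dgx := dg _ Ix; have dkx := dk _ Ix.
  move: (derive1 f x) (derive1 g x) dfx dgx => f' g' dfx dgx.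
  apply: (is_derive_unique I_open Ix E).
    by derive_by ltac:(rewrite /=; ring).
  by derive_by ltac:(rewrite /= -?/(k x); field).
(* [relation] and the Wronskian identity form a linear system for f' and g' whose determinant is, up
   to sign, twice the quadratic form, that is 2 k^2; Cramer's rule solves it. *)
have df' x : I x ->
    is_derive x 1 f (Phi f g x / 3 * f x + (b * f x + 2 * c * g x) * k x / 2).
  move=> Ix; apply: is_derive_rew (df _ Ix) _.
  have kn := k0 Ix; have := relation _ Ix; have := WE' x; have := E _ Ix; rewrite -/(k x).
  move: (derive1 f x) (derive1 g x) (f x) (g x) (Phi f g x) (k x) kn.
  move=> f1 g1 f0 gx P kx kn E0 E1 E2.
  apply: (mulfI (_ : 2 * kx ^+ 2 != 0)); first by rewrite mulf_neq0 ?expf_neq0 ?pnatr_eq0.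
  transitivity (f0 * (2 / 3 * P * kx ^+ 2) + (b * f0 + 2 * c * gx) * kx ^+ 3); last by field.
  by rewrite -E2 -E1 -E0; ring.
have dg' x : I x ->
    is_derive x 1 g (Phi f g x / 3 * g x - (2 * a * f x + b * g x) * k x / 2).
  move=> Ix; apply: is_derive_rew (dg _ Ix) _.
  have kn := k0 Ix; have := relation _ Ix; have := WE' x; have := E _ Ix; rewrite -/(k x).
  move: (derive1 f x) (derive1 g x) (f x) (g x) (Phi f g x) (k x) kn.
  move=> f1 g1 f0 gx P kx kn E0 E1 E2.
  apply: (mulfI (_ : 2 * kx ^+ 2 != 0)); first by rewrite mulf_neq0 ?expf_neq0 ?pnatr_eq0.
  transitivity (gx * (2 / 3 * P * kx ^+ 2) - (2 * a * f0 + b * gx) * kx ^+ 3); last by field.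
  by rewrite -E2 -E1 -E0; ring.
(* The matrix of the system for p and q is trace-free, so its square is minus its determinant, (b^2
   - 4 a c) / 4, times the identity; l^2 comes from k = l phi'. *)
pose alpha := l ^+ 2 * (b ^+ 2 - 4 * a * c) / 4.
pose p x := f x / k x; pose q x := g x / k x.
pose p1 x := l / 2 * (b * p x + 2 * c * q x).
pose q1 x := - (l / 2) * (2 * a * p x + b * q x).
have dquot h h1 x : I x -> is_derive x 1 h (Phi f g x / 3 * h x + h1 * k x / 2) ->
    is_derive x 1 (fun x => h x / k x) (h1 / 2).
  move=> Ix dh; have kn := k0 Ix.
  apply: is_derive_rew (is_deriveME dh (is_deriveVE kn (dk _ Ix))) _.
  by field.
have kjx x : I x -> k x = l * j x by exact: kj.
have dp x : I x -> is_derive x 1 p (j x * p1 x).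
  move=> Ix; apply: is_derive_rew (dquot f _ x Ix (df' x Ix)) _.
  have := k0 Ix; rewrite /p1 /p /q kjx// mulf_eq0 negb_or l0 /= => jn.
  by field; rewrite jn l0.
have dq x : I x -> is_derive x 1 q (j x * q1 x).
  move=> Ix; have := dg' x Ix; rewrite -mulNr -mulNr => /(dquot g _ x Ix)/is_derive_rew; apply.
  have := k0 Ix; rewrite /q1 /p /q kjx// mulf_eq0 negb_or l0 /= => jn.
  by field; rewrite jn l0.
have dp1 x : I x -> is_derive x 1 p1 (j x * (alpha * p x)).
  move=> Ix; have dpx := dp x Ix; have dqx := dq x Ix.
  rewrite /p1 /q1 in dpx dqx *; clearbody p q.
  by derive_by ltac:(rewrite /alpha; field).
have dq1 x : I x -> is_derive x 1 q1 (j x * (alpha * q x)).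
  move=> Ix; have dpx := dp x Ix; have dqx := dq x Ix.
  rewrite /p1 /q1 in dpx dqx *; clearbody p q.
  by derive_by ltac:(rewrite /alpha; field).
have [kap kap0 SC] := S_C_derive alpha; have kapn := lt0r_neq0 kap0.
pose S x := S_ alpha (phi x); pose C x := C_ alpha (phi x).
have dS x : I x -> is_derive x 1 S (kap * C x * j x).
  by move=> Ix; have [dS _ _] := SC (phi x); exact: is_derive_compE dS (dphi x Ix).
have dC x : I x -> is_derive x 1 C (alpha / kap * S x * j x).
  by move=> Ix; have [_ dC _] := SC (phi x); exact: is_derive_compE dC (dphi x Ix).
have SC1 x : C x ^+ 2 - alpha / kap ^+ 2 * S x ^+ 2 = 1 by have [] := SC (phi x).
have solution (u u1 : R -> R) : (forall x, I x -> is_derive x 1 u (j x * u1 x)) ->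
    (forall x, I x -> is_derive x 1 u1 (j x * (alpha * u x))) ->
    exists A B, forall x, I x -> u x = A * C x + B / kap * S x /\
      u1 x = B * C x + alpha / kap * A * S x.
  move=> du du1.
  (* Variation of constants: [A] and [B] are the coordinates of (u, u1) in the fundamental system
     built from C and S / kap, inverted by means of [SC1]. *)
  pose A x := u x * C x - u1 x * S x / kap.
  pose B x := u1 x * C x - alpha * u x * S x / kap.
  have dA x : I x -> is_derive x 1 A 0.
    move=> Ix; have ? := dS x Ix; have ? := dC x Ix; have ? := du x Ix; have ? := du1 x Ix.
    by rewrite /A; clearbody S C; derive_by ltac:(field).
  have dB x : I x -> is_derive x 1 B 0.
    move=> Ix; have ? := dS x Ix; have ? := dC x Ix; have ? := du x Ix; have ? := du1 x Ix.
    by rewrite /B; clearbody S C; derive_by ltac:(field).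
  exists (A x0), (B x0) => x Ix.
  rewrite (is_derive0_constant I_itv dA Ix0 Ix) (is_derive0_constant I_itv dB Ix0 Ix).
  by split; rewrite -[LHS]mulr1 -(SC1 x) /A /B; field.
have [Ap [Bp Ep]] := solution p p1 dp dp1.
have [Aq [Bq Eq]] := solution q q1 dq dq1.
exists alpha; apply: pair_equivC.
exists (l * Bp / kap), (l * Ap), (l * Bq / kap), (l * Aq); split.
  (* Up to the identity [SC1] this is p1 q - p q1, which equals l (a p^2 + b p q + c q^2), and the
     quadratic relation makes the bracket 1. *)
  have det : Bp * Aq - Ap * Bq = l.
    transitivity (p1 x0 * q x0 - p x0 * q1 x0).
      have [-> ->] := Ep _ Ix0; have [-> ->] := Eq _ Ix0.
      by rewrite -[LHS]mulr1 -(SC1 x0); field.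
    have := E _ Ix0; rewrite -/(k x0) /p1 /q1 /p /q => E0.
    move: (k0 Ix0) => kn.
    transitivity (l * (a * f x0 ^+ 2 + b * f x0 * g x0 + c * g x0 ^+ 2) / k x0 ^+ 2).
      by field.
    by rewrite E0; field.
  rewrite -subr_eq0 (_ : _ - _ = l ^+ 2 / kap * (Bp * Aq - Ap * Bq)); last by field.
  by rewrite det !mulf_neq0// ?invr_neq0// ?expf_neq0.
move=> x Ix; rewrite (is_derive_val (dphi x Ix)) -/(S x) -/(C x).
have kn := k0 Ix.
have fE : f x = k x * p x by rewrite /p mulrC divfK.
have gE : g x = k x * q x by rewrite /q mulrC divfK.
have [Epx _] := Ep _ Ix; have [Eqx _] := Eq _ Ix.
by rewrite fE gE Epx Eqx kjx//; split; ring.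
Qed.

End polynomial_generator.

Section hyperbolic_addition.
Variables (R : realType) (alpha : R).
Implicit Types (t c : R).

Lemma S_addition c t : S_ alpha (t - c) = S_ alpha t * C_ alpha c - C_ alpha t * S_ alpha c.
Proof.
rewrite /S_ /C_; case: ifP => _; first by rewrite mulrBr sinB.
case: ifP => _; first by rewrite mulr1 mul1r.
rewrite mulrBr opprB addrC !expRD expRN.
rewrite [expR (- (_ * c))]expRN; move: (expR_gt0 (Num.sqrt alpha * t)).
move: (expR_gt0 (Num.sqrt alpha * c)) => /lt0r_neq0 + /lt0r_neq0.
move: (expR _) (expR _) => v u v0 u0.
by field; rewrite u0 v0.
Qed.

(** An odd function has even primitives. Evenness is what makes the integral between two points
    symmetric about phi m vanish. *)
Lemma S_primitive : exists T : R -> R,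
  (forall t, is_derive t 1 T (S_ alpha t)) /\ (forall t, T (- t) = T t).
Proof.
have [->|alpha0] := eqVneq alpha 0.
  exists (fun t => t ^+ 2 / 2); split=> t; last by rewrite sqrrN.
  by rewrite /S_ ltxx eqxx; derive_by ltac:(rewrite /=; field).
have [kap kap0 SC] := S_C_derive alpha; have kapn := lt0r_neq0 kap0.
exists (fun t => kap / alpha * C_ alpha t); split=> t.
  have [_ dC _] := SC t; derive_by ltac:(field; rewrite ?alpha0 ?kapn//).
congr (_ * _); rewrite /C_; case: ifP => _; first by rewrite mulrN cosN.
by case: ifP => // _; rewrite mulrN opprK addrC.
Qed.

End hyperbolic_addition.

Section quasiarithmetic.
Variables (R : realType) (I : set R).
Hypotheses (I_itv : is_interval I) (I_open : open I).
Variables f g : R -> R.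
Hypothesis fgC : Cn_pair 6 I f g.
Variables (phi : R -> R) (alpha : R).
Hypotheses (phi_mono : strictly_monotone I phi)
  (phi_derivable : forall x, I x -> derivable phi x 1).
Hypothesis fg_phi : pair_equiv I f g (fun x => derive1 phi x * S_ alpha (phi x))
                                     (fun x => derive1 phi x * C_ alpha (phi x)).
Notation M := (gmean I f g (@lebesgue01 R)).

Let cf : Cn 6 I f. Proof. by case: fgC. Qed.
Let cg : Cn 6 I g. Proof. by case: fgC. Qed.
Let g0 x : I x -> 0 < g x. Proof. exact: (pair_gt0 fgC). Qed.
Let dphi x : I x -> is_derive x 1 phi (derive1 phi x).
Proof. by move=> Ix; apply: derivable_is_derive; exact: phi_derivable. Qed.
Let phi_cont x : I x -> {for x, continuous phi}.
Proof. by move=> /dphi; exact: is_derive_continuous. Qed.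
Let phi_inj : {in I &, injective phi}. Proof. exact: strictly_monotone_inj. Qed.

(* [f m * g z - g m * f z] is a multiple of [phi' z * S_ alpha (phi m - phi z)],
   and [phi m] is the midpoint of [phi x] and [phi y], so that its integral
   vanishes because [S_ alpha] is odd. *)
Lemma gmean_qa_mean : eq_on_square I M (qa_mean I phi).
Proof.
move=> x y Ix Iy.
have [a [b [c [d [abcd E]]]]] := pair_equivC fg_phi.
have [m Im Em] := qa_mean_exists I_itv phi_cont Ix Iy.
rewrite (qa_mean_eq phi_inj Im Em).
have f_cont z : I z -> {for z, continuous f} by exact: (Cn_continuous cf).
have g_cont z : I z -> {for z, continuous g} by exact: (Cn_continuous cg).
apply: (gmean_eq I_itv I_open) => //; first exact: (quotient_inj I_itv I_open fgC).
(* The integral formula below gives the average times x - y, so equal arguments are treated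
   apart. *)
have [xy|xy] := eqVneq x y.
  have -> : m = x by apply: phi_inj; rewrite ?inE// Em -xy; field.
  by rewrite -xy !segment_mean_diag mulrC.
pose h z := f m * g z + - g m * f z.
have h_cont z : I z -> {for z, continuous h}.
  by move=> Iz; have ? := Cn_is_derive (isT : 0 < 6)%N cf Iz;
    have ? := Cn_is_derive (isT : 0 < 6)%N cg Iz;
    apply: is_derive_continuous; rewrite /h; derive_by reflexivity.
have [T [dT evenT]] := S_primitive alpha.
pose D := (a * d - b * c) * derive1 phi m.
have hH : antiderivative I h (fun z => - D * T (phi z - phi m)).
  move=> z Iz; have dTz := is_derive_compE (g := fun z => phi z - phi m) (dT _)
    (is_deriveDE (dphi Iz) (is_derive_cstE (- phi m) z)).
  apply: is_derive_rew (is_deriveME (is_derive_cstE (- D) z) dTz) _.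
  have [Efm Egm] := E _ Im; have [Efz Egz] := E _ Iz.
  by rewrite /h Efm Egm Efz Egz S_addition /D; ring.
have := segment_meanE I_itv h_cont hH Ix Iy.
have -> : phi x - phi m = - (phi y - phi m) by rewrite Em; field.
rewrite evenT subrr => /eqP; rewrite mulf_eq0 subr_eq0 (negbTE xy) /=.
rewrite /h (segment_mean_linear I_itv _ _ g_cont f_cont Ix Iy) mulNr subr_eq0.
by move=> /eqP.
Qed.

(** Formally the Wronskian of u = phi' S and v = phi' C is kap phi'^3, but phi'' may fail to exist.
    Instead u C = v S is differentiated, where u and v are combinations of f and g, and u' C - v' S
    is multiplied by phi'. The constant combines kap with the determinant relating (u, v) to (f,
    g). *)
Lemma cbrtW_derive1 : exists2 c : R, c != 0 & forall x, I x ->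
  cbrt (W 1 0 f g x) = c * derive1 phi x.
Proof.
have [a [b [c [d [abcd E]]]]] := fg_phi.
have [kap kap0 SC] := S_C_derive alpha; have kapn := lt0r_neq0 kap0.
pose u x := a * f x + b * g x; pose v x := c * f x + d * g x.
pose S x := S_ alpha (phi x); pose C x := C_ alpha (phi x).
have D0 : a * d - b * c != 0 by rewrite subr_eq0.
exists (cbrt (kap / (a * d - b * c))).
  by rewrite cbrt_eq0 mulf_neq0// invr_neq0.
move=> x Ix; apply: cube_inj; rewrite /= cbrtK [RHS]exprMn cbrtK.
have c1 h : Cn 6 I h -> Cn 1 I h by exact: Cn_leq.
have Wuv := W_linear I_open (F := u) (G := v) (c1 f cf) (c1 g cg) Ix
  (fun _ _ => erefl) (fun _ _ => erefl).
apply: (mulfI D0); rewrite -Wuv.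
have df := Cn_is_derive (isT : 0 < 6)%N cf Ix.
have dg := Cn_is_derive (isT : 0 < 6)%N cg Ix.
have du : is_derive x 1 u (derive1 u x).
  by apply: derivable_is_derive; apply: is_derive_derivable; rewrite /u; derive_by reflexivity.
have dv : is_derive x 1 v (derive1 v x).
  by apply: derivable_is_derive; apply: is_derive_derivable; rewrite /v; derive_by reflexivity.
have [dS dC SC1] := SC (phi x).
have {}dS : is_derive x 1 S _ := is_derive_compE dS (dphi Ix).
have {}dC : is_derive x 1 C _ := is_derive_compE dC (dphi Ix).
have uv z : I z -> u z * C z = v z * S z.
  by move=> /E[Eu Ev]; rewrite /u /v -Eu -Ev /S /C; ring.
have := is_derive_unique I_open Ix uv (is_deriveME du dC) (is_deriveME dv dS).
have [Eu Ev] := E _ Ix; rewrite -/(u x) -/(v x) -/(S x) -/(C x) in Eu Ev.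
rewrite -/(S x) -/(C x) in SC1 *; rewrite /W !derive1n0 /derive1n /= -Eu -Ev.
move: (derive1 u x) (derive1 v x) (derive1 phi x) (S x) (C x) SC1 => u' v' p s k SC1 eq1.
transitivity (kap * p ^+ 3 * (k ^+ 2 - alpha / kap ^+ 2 * s ^+ 2)); last first.
  by rewrite SC1; field.
apply/eqP; rewrite -subr_eq0; apply/eqP.
transitivity (p * (u' * k + p * s * (alpha / kap * s * p) - (v' * s + p * k * (kap * k * p)))).
  by field.
by rewrite eq1 subrr mulr0.
Qed.

Lemma qa_mean_scale (c : R) : c != 0 ->
  eq_on_square I (qa_mean I phi) (qa_mean I (fun x => c * phi x)).
Proof.
move=> c0 x y Ix Iy; have [m Im Em] := qa_mean_exists I_itv phi_cont Ix Iy.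
rewrite (qa_mean_eq phi_inj Im Em); apply/esym/qa_mean_eq => //.
  by move=> u v Iu Iv /(mulfI c0); exact: phi_inj.
by rewrite Em; ring.
Qed.

End quasiarithmetic.

Section pair_equiv_mean.
Variables (R : realType) (I : set R).
Hypotheses (I_itv : is_interval I) (I_open : open I).
Variables f g F G : R -> R.
Hypotheses (fgC : Cn_pair 6 I f g) (FGC : Cn_pair 6 I F G).

(** A linear change of the pair multiplies f(m) J_g - g(m) J_f by its determinant, so the zero [m]
    is kept. *)
Lemma pair_equiv_gmean : pair_equiv I f g F G ->
  eq_on_square I (gmean I f g (@lebesgue01 R)) (gmean I F G (@lebesgue01 R)).
Proof.
move=> [a [b [c [d [_ E]]]]] x y Ix Iy.
have cont u v : Cn_pair 6 I u v -> (forall z, I z -> {for z, continuous u}) /\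
    (forall z, I z -> {for z, continuous v}).
  by case=> cu cv _ _; split=> z; [exact: (Cn_continuous cu)|exact: (Cn_continuous cv)].
have [cf cg] := cont _ _ fgC; have [cF cG] := cont _ _ FGC.
have gp z := pair_gt0 fgC (x := z); have Gp z := pair_gt0 FGC (x := z).
have [Im Em] := gmean_spec I_itv I_open cf cg gp (quotient_inj I_itv I_open fgC) Ix Iy.
apply/esym/(gmean_eq I_itv I_open) => //; first exact: (quotient_inj I_itv I_open FGC).
have J h (k l : R) : (forall z, I z -> h z = k * f z + l * g z) ->
    segment_mean h x y = k * segment_mean f x y + l * segment_mean g x y.
  move=> Eh; rewrite -(segment_mean_linear I_itv _ _ cf cg Ix Iy).
  apply: eq_Rintegral => t /set_mem t01; apply: Eh; exact: itv_convex.
rewrite (J F a b) ?(J G c d); [|by move=> z /E[]..].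
have [-> ->] := E _ Im; move: Em.
move: (gmean _ _ _ _ _ _) (segment_mean f x y) (segment_mean g x y) => m u v Em.
apply/eqP; rewrite -subr_eq0; apply/eqP.
transitivity ((a * d - b * c) * (f m * v - g m * u)); first by ring.
by rewrite Em subrr mulr0.
Qed.

End pair_equiv_mean.

(** * The cycle of implications *)

Theorem theorem16 (R : realType) (I : set R) (f g F G : R -> R)
  (I_itv : is_interval I) (I_open : open I) (I_neq0 : I !=set0)
  (fgC6 : Cn_pair 6 I f g) (FGC6 : Cn_pair 6 I F G) :
  let Mfg := gmean I f g (@lebesgue01 R) in
  let MFG := gmean I F G (@lebesgue01 R) in
  let mfg := gmean_diag I f g (@lebesgue01 R) in
  let mFG := gmean_diag I F G (@lebesgue01 R) in
  [<->
    (* (i) *)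
    eq_on_square I Mfg MFG;
    (* (ii) *)
    eq_near_diagonal I Mfg MFG;
    (* (iii) *)
    forall x, I x ->
      [/\ derive1n 2 (mfg x) 0 = derive1n 2 (mFG x) 0,
          derive1n 4 (mfg x) 0 = derive1n 4 (mFG x) 0 &
          derive1n 6 (mfg x) 0 = derive1n 6 (mFG x) 0];
    (* (iv); fails for (f, g) = (F, G) = (expR, 1) without the first disjunct *)
    pair_equiv I f g F G \/
    (forall x, I x -> Phi f g x = Phi F G x) /\
    exists alpha beta : R, forall x, I x ->
      Psi f g x = alpha * cbrt (W 1 0 f g x) ^+ 2
                  + 3^-1 * derive1 (Phi f g) x - 2 / 9 * Phi f g x ^+ 2 /\
      Psi F G x = beta * cbrt (W 1 0 f g x) ^+ 2
                  + 3^-1 * derive1 (Phi f g) x - 2 / 9 * Phi f g x ^+ 2;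
    (* (v) *)
    pair_equiv I f g F G \/
    exists a b c A B C gamma : R, forall x, I x ->
      [/\ a * f x ^+ 2 + b * f x * g x + c * g x ^+ 2 = cbrt (W 1 0 f g x) ^+ 2,
          A * F x ^+ 2 + B * F x * G x + C * G x ^+ 2 = cbrt (W 1 0 F G x) ^+ 2 &
          W 1 0 F G x = gamma * W 1 0 f g x];
    (* (vi); the absolute values only matter when f/g or F/G is decreasing *)
    pair_equiv I f g F G \/
    exists P Q : {poly R},
      [/\ (size P <= 3)%N, (size Q <= 3)%N,
          forall x, I x -> 0 < P.[f x / g x] &
          forall x, I x -> 0 < Q.[F x / G x]] /\
      exists gamma delta : R,
      [/\ forall x, I x ->
            g x = `|derive1 (fun z => f z / g z) x| * (Num.sqrt (P.[f x / g x] ^+ 3))^-1,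
          forall x, I x ->
            G x = `|derive1 (fun z => F z / G z) x| * (Num.sqrt (Q.[F x / G x] ^+ 3))^-1 &
          exists intP intQ : R -> R,
          [/\ antiderivative [set f x / g x | x in I] (fun y => P.[y]^-1) intP,
              antiderivative [set F x / G x | x in I] (fun y => Q.[y]^-1) intQ &
              forall x, I x ->
                intQ (F x / G x) = cbrt gamma * intP (f x / g x) + delta]];
    (* (vii) *)
    pair_equiv I f g F G \/
    exists (phi : R -> R) (alpha beta : R),
      [/\ strictly_monotone I phi,
          forall x, I x -> derivable phi x 1,
          pair_equiv I f g (fun x => derive1 phi x * S_ alpha (phi x))
                           (fun x => derive1 phi x * C_ alpha (phi x)) &
          pair_equiv I F G (fun x => derive1 phi x * S_ beta (phi x))
                           (fun x => derive1 phi x * C_ beta (phi x))];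
    (* (viii) *)
    pair_equiv I f g F G \/
    exists phi : R -> R,
      [/\ antiderivative I (fun x => cbrt (W 1 0 f g x)) phi,
          eq_on_square I Mfg (qa_mean I phi) &
          eq_on_square I (qa_mean I phi) MFG];
    (* (ix) *)
    pair_equiv I f g F G \/
    exists phi : R -> R,
      [/\ strictly_monotone I phi,
          {within I, continuous phi},
          eq_on_square I Mfg (qa_mean I phi) &
          eq_on_square I (qa_mean I phi) MFG]
  ].
Proof.
move=> Mfg MFG mfg mFG; tfae.
- move=> E; exists (I `*` I), [set (x, x) | x in I]; split; last first.
    by move=> [x y] [Ix Iy]; exact: E.
  split => //.
  + rewrite openE => -[x y] [Ix Iy]; exists (I, I) => //.
    by split; exact: near_open.
  + exact: subset_closure.
  + by move=> _ [x Ix <-].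
- move=> /(near_diagonal_derivatives I_itv I_open fgC6 FGC6) E x Ix.
  by split; exact: E.
- exact: equation_of_derivatives.
- move=> [|[EPhi [alpha [beta EPsi]]]]; [by left|right].
  (* Both Wronskians solve y' = Phi y with the common [Phi]. *)
  have [|gamma EW] := linear_proportional I_itv (u := W 1 0 F G) (v := W 1 0 f g)
      (q := Phi f g) _ (is_derive_W10 fgC6) (W10_neq0 fgC6).
    by move=> x Ix; rewrite EPhi//; exact: (is_derive_W10 FGC6 Ix).
  have [x0 Ix0] := I_neq0.
  have gamma0 : cbrt gamma != 0.
    rewrite cbrt_eq0; apply: contraNneq (W10_neq0 FGC6 Ix0) => g0.
    by rewrite EW// g0 mul0r.
  have [|a [b [c E]]] := quadratic_relation I_itv I_open I_neq0 fgC6 (alpha := alpha).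
    by move=> x /EPsi[].
  (* In (iv) both equations use W_{f,g}; rewriting the second in terms of W_{F,G} = gamma W_{f,g}
     divides beta by the 2/3 power of gamma. *)
  have [|A [B [C E']]] := quadratic_relation I_itv I_open I_neq0 FGC6
      (alpha := beta / cbrt gamma ^+ 2).
    move=> x Ix; rewrite -EPhi// -(near_eq_derive1 (f := Phi f g)); last first.
      by apply: filterS (near_open I_open Ix) => y Iy; rewrite EPhi.
    have [_ ->] := EPsi _ Ix; rewrite EW// cbrtM.
    by congr (_ + _ - _); field.
  by exists a, b, c, A, B, C, gamma => x Ix; split; [exact: E|exact: E'|exact: EW].
- move=> [|[a [b [c [A [B [C [gamma E]]]]]]]]; [by left|right].
  have [|P P3 EP] := polynomial_of_quadratic fgC6 (a := a) (b := b) (c := c).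
    by move=> x /E[].
  have [|Q Q3 EQ] := polynomial_of_quadratic FGC6 (a := A) (b := B) (c := C).
    by move=> x /E[].
  exists P, Q; split.
    by split => // x Ix; [case: (generator_of_polynomial fgC6 EP Ix)
                         |case: (generator_of_polynomial FGC6 EQ Ix)].
  (* delta = 0 because both antiderivatives below are built from the same phi, the second one with
     the factor [cbrt gamma]. *)
  exists gamma, 0; split.
  + by move=> x Ix; case: (generator_of_polynomial fgC6 EP Ix).
  + by move=> x Ix; case: (generator_of_polynomial FGC6 EQ Ix).
  have [phi dphi] := antiderivative_exists I_itv I_open (cbrtW_continuous fgC6).
  have dphi' : antiderivative I (fun x => cbrt (W 1 0 F G x)) (fun x => cbrt gamma * phi x).
    move=> x Ix; have [_ _ ->] := E _ Ix; rewrite cbrtM.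
    have ? := dphi x Ix; by derive_by ltac:(ring).
  eexists; eexists; split.
  + exact: antiderivative_inv_quotient EP dphi.
  + exact: antiderivative_inv_quotient EQ dphi'.
  + move=> x Ix; rewrite addr0.
    by rewrite (inv_onK (quotient_inj I_itv I_open fgC6) Ix)
       (inv_onK (quotient_inj I_itv I_open FGC6) Ix).
- move=> [|[P [Q [[P3 Q3 P0 Q0] [gamma [delta [Eg EG [intP [intQ [dP dQ EPQ]]]]]]]]]].
    by left.
  right.
  have EP := quadratic_of_generator fgC6 P0 Eg.
  have EQ := quadratic_of_generator FGC6 Q0 EG.
  have dphi x (Ix : I x) := is_derive_comp_quotient fgC6 EP dP Ix.
  have dpsi x (Ix : I x) := is_derive_comp_quotient FGC6 EQ dQ Ix.
  have quad u v (uvC : Cn_pair 6 I u v) (p : {poly R}) : (size p <= 3)%N ->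
      (forall x, I x -> p.[u x / v x] = (cbrt (W 1 0 u v x) / v x) ^+ 2) ->
      forall x, I x -> p`_2 * u x ^+ 2 + p`_1 * u x * v x + p`_0 * v x ^+ 2
                       = cbrt (W 1 0 u v x) ^+ 2.
    move=> p3 Ep x Ix; have := Ep x Ix; rewrite (horner_quotient uvC p3 Ix) expr_div_n.
    by apply: mulIf; rewrite invr_neq0// expf_neq0// lt0r_neq0// (pair_gt0 uvC).
  (* phi' is the cube root of W_{f,g}. Differentiating the relation between the two integrals shows
     that the cube root of W_{F,G} is [cbrt gamma] times phi', so phi serves both pairs. *)
  pose phi x := intP (f x / g x).
  have EW x : I x -> cbrt (W 1 0 F G x) = cbrt gamma * cbrt (W 1 0 f g x).
    move=> Ix; apply: (is_derive_unique I_open Ix EPQ (dpsi x Ix)).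
    by have ? := dphi x Ix; derive_by ltac:(ring).
  have [alpha fg_phi] := oscillation I_itv I_open fgC6 (quad _ _ fgC6 P P3 EP)
    (phi := phi) (j := fun x => cbrt (W 1 0 f g x)) (l := 1) dphi
    (fun x _ => esym (mul1r _)) I_neq0.
  have [beta FG_phi] := oscillation I_itv I_open FGC6 (quad _ _ FGC6 Q Q3 EQ)
    (phi := phi) (j := fun x => cbrt (W 1 0 f g x)) (l := cbrt gamma) dphi EW I_neq0.
  exists phi, alpha, beta; split => //.
  + apply: (derive_neq0_strictly_monotone I_itv dphi).
      exact: (cbrtW_continuous fgC6).
    exact: (cbrtW_neq0 fgC6).
  + by move=> x Ix; exact: is_derive_derivable (dphi x Ix).
- move=> [|[phi [alpha [beta [phi_mono dphi fg_phi FG_phi]]]]]; [by left|right].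
  have Efg := gmean_qa_mean I_itv I_open fgC6 phi_mono dphi fg_phi.
  have EFG := gmean_qa_mean I_itv I_open FGC6 phi_mono dphi FG_phi.
  (* The given phi need not be the antiderivative prescribed by (viii); c times phi is one, and it
     generates the same quasiarithmetic mean. *)
  have [c c0 Ec] := cbrtW_derive1 I_open fgC6 dphi fg_phi.
  have Es := qa_mean_scale I_itv phi_mono dphi c0.
  exists (fun x => c * phi x); split.
  + move=> x Ix; have ? := derivable_is_derive (dphi x Ix).
    by derive_by ltac:(rewrite Ec//; ring).
  + by move=> x y Ix Iy; exact: (etrans (Efg x y Ix Iy) (Es x y Ix Iy)).
  + by move=> x y Ix Iy; exact: (etrans (esym (Es x y Ix Iy)) (esym (EFG x y Ix Iy))).
- move=> [|[phi [dphi E1 E2]]]; [by left|right].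
  exists phi; split => //.
  + apply: (derive_neq0_strictly_monotone I_itv dphi).
      exact: (cbrtW_continuous fgC6).
    exact: (cbrtW_neq0 fgC6).
  + apply: continuous_in_subspaceT => x /set_mem Ix.
    exact: (is_derive_continuous (dphi x Ix)).
- move=> [E|[phi [_ _ E1 E2]]].
    exact: pair_equiv_gmean.
  by move=> x y Ix Iy; rewrite E1// E2.
Qed.
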